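(* Any planar graph with $n$ vertices and $m$ edges contains a matching of size at least $(m-2n)/3$.
   Context: Graphs are finite, simple and undirected. *)

(* Defs.v *)
(* MathComp world, with MathComp-Analysis for the topology of the plane. *)
From mathcomp Require Import all_boot all_order all_algebra.
From mathcomp Require Import all_classical all_reals all_analysis.

Set Implicit Arguments.
Unset Strict Implicit.
Unset Printing Implicit Defensive.

Import Order.TTheory GRing.Theory Num.Theory.
Import numFieldNormedType.Exports.

Record sgraph := SGraph {
  vertex :> finType;
  adj : rel vertex;
  adj_sym : symmetric adj;
  adj_irrefl : irreflexive adj }.

(* An edge is the two-element set of its ends, so each is counted once. *)
Definition edges (G : sgraph) : {set {set G}} :=
  [set [set p.1; p.2]%SET | p : G * G & adj p.1 p.2]%SET.

Definition matching (G : sgraph) (M : {set {set G}}) : Prop :=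
  M \subset edges G /\ finset.trivIset M.

Local Open Scope classical_set_scope.
Local Open Scope ring_scope.

(* P is an arc in the plane with ends a and b: the image of [0, 1] under a
   continuous injection sending 0 to a and 1 to b. *)
Definition is_arc (R : realType) (a b : R * R) (P : set (R * R)) : Prop :=
  exists f : R -> R * R,
    [/\ {within `[0, 1], continuous f},
        {in `[0, 1] &, injective f},
        f 0 = a, f 1 = b & P = f @` `[0, 1] ].

Record is_drawing (R : realType) (G : sgraph)
    (pos : G -> R * R) (arc : {set G} -> set (R * R)) : Prop := IsDrawing {
  drawing_pos_inj : injective pos;
  drawing_arc : forall x y : G, adj x y ->
    is_arc (pos x) (pos y) (arc [set x; y]%SET);
  (* the interior of an edge contains no vertex ... *)
  drawing_vertex : forall A : {set G}, A \in edges G ->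
    (arc A `\` pos @` [set` A]) `&` range pos = set0;
  (* ... and no point of any other edge *)
  drawing_edge : forall A B : {set G}, A \in edges G -> B \in edges G ->
    A != B -> (arc A `\` pos @` [set` A]) `&` arc B = set0 }.

Definition planar (R : realType) (G : sgraph) : Prop :=
  exists (pos : G -> R * R) (arc : {set G} -> set (R * R)),
    is_drawing pos arc.

(* Main.v *)
(* Crossing parities turn a planar drawing into linear equations over F_2.
   For an edge e and a vertex v let c(e, v) be the parity of the number of
   times e crosses the ray from v in direction (1, 0). If e = aa' and f = bb'
   have no common end, their arcs are disjoint, so (s, t) |-> e(s) - f(t) maps
   the unit square into the punctured plane; its boundary crosses the ray from
   the origin an even number of times, which reads
     c(e, b) + c(e, b') + c(f, a) + c(f, a')
       = h(a, b) + h(a, b') + h(a', b) + h(a', b'),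
   where h compares the positions of two vertices lexicographically.
   The existence of such a c is inherited by minors, and summing the equations
   refutes it for K_5 and K_{3,3}. Excluding these minors gives, for k vertices,
   at most 3k edges in general and at most 2k - 4 for bipartite graphs (k >= 3).

   For the matching, let S maximize |S| - |N(S)|; S may be taken independent.
   Let U = N(S), W the set of the remaining vertices, and s, u, w the three
   cardinals. By Hall's theorem U is matched into S, and W carries a permutation
   moving every vertex to a neighbour, hence has a matching of size w/3. So
   there is a matching of size at least u + w/3, while
   m <= 3(u + w) + 2(u + s) = 2n + 3(u + w/3). *)

Require Import Defs.
From Stdlib Require Import Ring.
From mathcomp Require Import all_boot all_order all_algebra.
From mathcomp Require Import all_classical all_reals all_analysis.
From mathcomp Require Import zify lra.

Set Implicit Arguments.
Unset Strict Implicit.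
Unset Printing Implicit Defensive.

Import Order.TTheory GRing.Theory Num.Theory.
Import numFieldNormedType.Exports.

(** * Crossing parities and minors *)

Section CrossingParity.
Import fintype boot.finset.
Variables (V : finType) (h : rel V).
Hypothesis h_anti : forall x y, x != y -> h x y = ~~ h y x.
Implicit Types (f g : V -> bool) (W : V -> V -> V -> bool) (A B : {set V}) (e : rel V).

(* f v and g v are the crossing parities, as seen from v, of curves that lead from
   x to y and from z to t; disjointness of the two curves implies this equation. *)
Definition bal f x y g z t :=
  f z (+) f t (+) (g x (+) g y) (+) (h x z (+) h x t (+) (h y z (+) h y t))
  = false.

Lemma addb_xorb a b : a (+) b = xorb a b.
Proof. by case: a; case: b. Qed.

(** Exchanging the curves reverses each of the four comparisons, and four negations cancel modulo
    2. *)
Lemma balC f x y g z t : x != z -> x != t -> y != z -> y != t ->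
  bal f x y g z t -> bal g z t f x y.
Proof.
move=> xz xt yz yt; rewrite /bal => <-.
rewrite (h_anti xz) (h_anti xt) (h_anti yz) (h_anti yt) -!addTb !addb_xorb.
ring.
Qed.

(** Concatenating two curves adds their parities; the terms of the middle point [y] occur twice and
    cancel. *)
Lemma bal_trans f1 f2 x y w g z t : bal f1 x y g z t -> bal f2 y w g z t ->
  bal (fun v => f1 v (+) f2 v) x w g z t.
Proof.
rewrite /bal => e1 e2; rewrite -[RHS]/(false (+) false) -{1}e1 -e2 !addb_xorb.
ring.
Qed.

Lemma bal_sym f x y g z t : bal f x y g z t -> bal f y x g z t.
Proof. by rewrite /bal => <-; rewrite !addb_xorb; ring. Qed.

(** Here [t i] sums the parities of the edges at [u i], each seen from the two other [w k]. For
    fixed [i < i'], adding the equations of the six ordered pairs [j != j'] cancels everything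
    except [t i], [t i'] and [h (w j) (w j') (+) h (w j') (w j)] for three pairs, an odd sum. So the
    three bits [t 0], [t 1], [t 2] would be pairwise distinct. *)
Lemma K33_not_bal (u w : nat -> V) (E : nat -> nat -> V -> bool) :
  (forall i j, i < j < 3 -> w i != w j) ->
  ~ (forall i i' j j', i < i' < 3 -> j < 3 -> j' < 3 -> j != j' ->
     bal (E i j) (u i) (w j) (E i' j') (u i') (w j')).
Proof.
move=> winj H.
have Hw i j : i < j < 3 -> h (w j) (w i) = xorb true (h (w i) (w j)).
  by move=> ij; rewrite (h_anti (x := w j)) 1?eq_sym ?winj //; case: (h _ _).
pose t i := xorb (xorb (E i 0 (w 1)) (E i 0 (w 2)))
  (xorb (xorb (E i 1 (w 0)) (E i 1 (w 2))) (xorb (E i 2 (w 0)) (E i 2 (w 1)))).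
have Ht i i' : i < i' < 3 -> xorb (t i) (t i') = true.
  move=> ii'; move: (H i i' 0 1 ii' isT isT isT) (H i i' 0 2 ii' isT isT isT)
    (H i i' 1 0 ii' isT isT isT) (H i i' 1 2 ii' isT isT isT)
    (H i i' 2 0 ii' isT isT isT) (H i i' 2 1 ii' isT isT isT).
  rewrite /bal !addb_xorb (Hw 0 1) // (Hw 0 2) // (Hw 1 2) // => E1 E2 E3 E4 E5 E6.
  rewrite -[true]/(xorb true (xorb false (xorb false (xorb false
    (xorb false (xorb false false)))))).
  by rewrite -{1}E1 -{1}E2 -{1}E3 -{1}E4 -{1}E5 -E6 /t; ring.
by move: (Ht 0 1 isT) (Ht 0 2 isT) (Ht 1 2 isT);
  case: (t 0); case: (t 1); case: (t 2).
Qed.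

(** Here [t i j k] sums the parities of the sides of a triangle, each seen from the opposite vertex.
    For four vertices, the three ways of splitting them into two disjoint edges add up to the
    statement that their four triangles have odd sum. Each triangle lies in two of the five
    quadruples, so the total over these is both even and odd. *)
Lemma K5_not_bal (u : nat -> V) (E : nat -> nat -> V -> bool) :
  (forall i j, i < j < 5 -> u i != u j) ->
  ~ (forall i j k l, i < j < 5 -> k < l < 5 -> i < k -> j != k -> j != l ->
     bal (E i j) (u i) (u j) (E k l) (u k) (u l)).
Proof.
move=> uinj H.
have Hu i j : i < j < 5 -> h (u j) (u i) = xorb true (h (u i) (u j)).
  by move=> ij; rewrite (h_anti (x := u j)) 1?eq_sym ?uinj //; case: (h _ _).
pose t i j k := xorb (E i j (u k)) (xorb (E i k (u j)) (E j k (u i))).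
have Ht i j k l : i < j -> j < k -> k < l -> l < 5 ->
    xorb (xorb (t i j k) (t i j l)) (xorb (t i k l) (t j k l)) = true.
  move=> ij jk kl l5.
  have E1 : bal (E i j) (u i) (u j) (E k l) (u k) (u l) by apply: H; lia.
  have E2 : bal (E i k) (u i) (u k) (E j l) (u j) (u l) by apply: H; lia.
  have E3 : bal (E i l) (u i) (u l) (E j k) (u j) (u k) by apply: H; lia.
  move: E1 E2 E3.
  have [hj hk hl] : [/\ h (u k) (u j) = xorb true (h (u j) (u k)),
      h (u l) (u j) = xorb true (h (u j) (u l)) &
      h (u l) (u k) = xorb true (h (u k) (u l))] by split; apply: Hu; lia.
  rewrite /bal !addb_xorb hj hk hl => E1 E2 E3.
  rewrite -[true]/(xorb true (xorb false (xorb false false))).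
  by rewrite -{1}E1 -{1}E2 -E3 /t; ring.
move: (Ht 0 1 2 3 isT isT isT isT) (Ht 0 1 2 4 isT isT isT isT)
  (Ht 0 1 3 4 isT isT isT isT) (Ht 0 2 3 4 isT isT isT isT)
  (Ht 1 2 3 4 isT isT isT isT) => E1 E2 E3 E4 E5.
have : false = true by rewrite -[RHS]/(xorb true (xorb true (xorb true (xorb true true))));
  rewrite -{1}E1 -{1}E2 -{1}E3 -{1}E4 -E5; ring.
by [].
Qed.

(** An algebraic substitute for planarity of the graph induced on [A]. It mentions no curves, so it
    passes to minors by adding parities. *)
Definition z2planar A e := exists W, forall a a' b b',
  a \in A -> a' \in A -> b \in A -> b' \in A -> e a a' -> e b b' ->
  a != b -> a != b' -> a' != b -> a' != b' ->
  bal (W a a') a a' (W b b') b b'.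

Lemma z2planarW A B e e' : A \subset B -> subrel e e' ->
  z2planar B e' -> z2planar A e.
Proof.
move=> /subsetP AB ee' [W HW]; exists W => a a' b b' aA a'A bA b'A /ee' ? /ee' ?.
by apply: HW => //; apply: AB.
Qed.

Fixpoint walk_parity W x p v :=
  if p is y :: q then W x y v (+) walk_parity W y q v else false.

(** The walk is a concatenation of edges, handled by [bal_trans]; for the empty walk all terms
    vanish or cancel in pairs. *)
Lemma walk_bal W A e x p b b' :
  (forall y z, y \in A -> z \in A -> e y z ->
     b != y -> b != z -> b' != y -> b' != z -> bal (W y z) y z (W b b') b b') ->
  {subset x :: p <= A} -> path e x p -> b \notin x :: p -> b' \notin x :: p ->
  bal (walk_parity W x p) x (last x p) (W b b') b b'.
Proof.
move=> H; elim: p x => [|y p IH] x sA /=.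
  by move=> _ _ _; rewrite /bal; case: (W b b' x); case: (h x b); case: (h x b').
case/andP => exy pp; rewrite 2!(in_cons x) 2!negb_or => /andP[bx bp] /andP[b'x b'p].
apply: (@bal_trans _ _ _ y); last first.
  by apply: IH => // z zp; apply: sA; rewrite in_cons zp orbT.
apply: H => //; try by apply: sA; rewrite !inE eqxx ?orbT.
- by move: bp; rewrite in_cons negb_or => /andP[].
- by move: b'p; rewrite in_cons negb_or => /andP[].
Qed.

(* b is identified with a; the caller removes b from the vertex set. *)
Definition contract a b e : rel V := fun x y =>
  [|| e x y, [&& x == a, y != a & e b y] | [&& y == a, x != a & e x b]].

Lemma contract_sym a b e : symmetric e -> symmetric (contract a b e).
Proof.
move=> es x y; rewrite /contract (es x y) (es b y) (es x b).
by case: (e y x) => //=; rewrite orbC.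
Qed.

Lemma contract_irrefl a b e : irreflexive e -> irreflexive (contract a b e).
Proof.
by move=> ei x; rewrite /contract ei; case: eqP => //=.
Qed.

(** A new edge from [a] is routed along the walk [p] and then along an edge at the end of [p]. All
    vertices of [p] are discarded, so an edge within [B] that avoids [a] avoids the whole walk.
    Walks of length two serve to contract [a]-[s]-[b] in one go. *)
Lemma z2planar_contract A B e a p : symmetric e ->
  path e a p -> {subset p <= A} -> B \subset A -> a \in B ->
  {in B, forall x, x \notin p} ->
  z2planar A e -> z2planar B (contract a (last a p) e).
Proof.
move=> es pp pA /subsetP BA aB Bp [W HW]; set b := last a p.
have apA : {subset a :: p <= A}.
  by move=> z; rewrite in_cons => /orP[/eqP->|/pA//]; apply: BA.
have bA : b \in A by apply: apA; rewrite mem_last.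
(* Old edges keep their parities; a new edge follows the walk from [a] to [b], at its start or, in
   the other direction, at its end. *)
pose W' x y := if e x y then W x y else
  if x == a then fun v => walk_parity W a p v (+) W b y v
  else fun v => W x b v (+) walk_parity W a p v.
exists W' => x y z t xB yB zB tB.
have bal_walk z' t' : z' \in B -> t' \in B -> e z' t' -> z' != a -> t' != a ->
    bal (walk_parity W a p) a b (W z' t') z' t'.
  move=> z'B t'B ezt za ta; apply: (walk_bal (A := A)) pp _ _ => //.
  - move=> c d cA dA ecd ? ? ? ?.
    by apply: HW => //; try exact: BA; rewrite eq_sym.
  - by rewrite in_cons negb_or za Bp.
  - by rewrite in_cons negb_or ta Bp.
have key x' y' z' t' : x' \in B -> y' \in B -> z' \in B -> t' \in B ->
    e z' t' -> contract a b e x' y' ->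
    x' != z' -> x' != t' -> y' != z' -> y' != t' ->
    bal (W' x' y') x' y' (W z' t') z' t'.
  move=> x'B y'B z'B t'B ezt + xz xt yz yt; rewrite /contract /W'.
  have bp c : c \in B -> c != a -> c != b.
    move=> cB ca; apply: contraNneq (Bp _ cB) => cb.
    by have := mem_last a p; rewrite -/b -cb in_cons (negPf ca).
  have [exy _|_ /=] := boolP (e x' y'); first by apply: HW; rewrite ?BA.
  case/orP => /and3P[/eqP ? ca eb]; subst.
    rewrite eqxx; apply: (@bal_trans _ _ _ b).
      by apply: bal_walk; rewrite // eq_sym.
    apply: HW; rewrite ?bA ?BA // 1?eq_sym; first by rewrite bp // eq_sym.
    by rewrite bp // eq_sym.
  rewrite (negPf ca); apply: (@bal_trans _ _ _ b).
    apply: HW; rewrite ?bA ?BA // 1?eq_sym; first by rewrite bp // eq_sym.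
    by rewrite bp // eq_sym.
  by apply: bal_sym; apply: bal_walk; rewrite // eq_sym.
move=> exy ezt xz xt yz yt.
have [old|new] := boolP (e z t).
  by rewrite {2}/W' old; apply: key.
have [old|new'] := boolP (e x y).
  rewrite {1}/W' old; apply: balC; rewrite 1?eq_sym //.
  by apply: key => //; rewrite eq_sym.
(* Two new edges both end at [a], so they are not disjoint. *)
move: exy ezt; rewrite /contract (negPf new) (negPf new') /=.
by do 2![case/orP => /and3P[/eqP ? _ _]]; subst; move: xz xt yz yt; rewrite eqxx.
Qed.

End CrossingParity.

(** * Counting adjacent pairs *)

Section ArcCounting.
Import fintype boot.finset.
Variable V : finType.
Implicit Types (A B C X Y : {set V}) (e : rel V) (a b x y : V).

Definition deg e A x := #|[set y in A | e x y]|.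
Definition cross e A B := \sum_(x in A) deg e B x.
(* Ordered pairs are counted: this is twice the number of edges. *)
Definition arcs e A := cross e A A.

Lemma degE e A x : deg e A x = \sum_(y in A) e x y.
Proof.
rewrite /deg -sum1_card big_mkcond [RHS]big_mkcond; apply: eq_bigr => y _.
by rewrite inE; case: (y \in A) => //=; case: (e x y).
Qed.

Lemma crossC e A B : symmetric e -> cross e A B = cross e B A.
Proof.
move=> es; rewrite /cross (eq_bigr _ (fun x _ => degE e B x)).
rewrite (eq_bigr _ (fun x _ => degE e A x)) exchange_big.
by apply: eq_bigr => x _; apply: eq_bigr => y _; rewrite es.
Qed.

Lemma crossUl e A B C : [disjoint A & B] ->
  cross e (A :|: B) C = cross e A C + cross e B C.
Proof.
by move=> dAB; rewrite /cross -bigU //=; apply: eq_bigl => x; rewrite inE.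
Qed.

Lemma crossUr e A B C : symmetric e -> [disjoint A & B] ->
  cross e C (A :|: B) = cross e C A + cross e C B.
Proof. by move=> es dAB; rewrite !(crossC C) ?crossUl. Qed.

Lemma cross1l e A x : cross e [set x] A = deg e A x.
Proof. by rewrite /cross big_set1. Qed.

Lemma arcsU e A B : symmetric e -> [disjoint A & B] ->
  arcs e (A :|: B) = arcs e A + arcs e B + 2 * cross e A B.
Proof.
move=> es dAB; rewrite /arcs crossUl // !crossUr // (crossC B A) //; lia.
Qed.

Lemma arcs1 e x : irreflexive e -> arcs e [set x] = 0.
Proof.
move=> ei; rewrite /arcs cross1l /deg; apply/eqP; rewrite cards_eq0.
by apply/eqP/setP => y; rewrite !inE; case: eqP => //= ->; rewrite ei.
Qed.

Lemma arcsU1 e A x : symmetric e -> irreflexive e -> x \notin A ->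
  arcs e (x |: A) = arcs e A + 2 * deg e A x.
Proof. by move=> es ei xA; rewrite arcsU ?disjoints1 // arcs1 // cross1l. Qed.

Lemma degU1 e A x y : y \notin A -> deg e (y |: A) x = e x y + deg e A x.
Proof. by move=> yA; rewrite !degE big_setU1. Qed.

Lemma arcsD1 e A x : symmetric e -> irreflexive e -> x \in A ->
  arcs e A = arcs e (A :\ x) + 2 * deg e A x.
Proof.
move=> es ei xA; rewrite -{1 3}(setD1K xA) arcsU1 ?degU1 ?ei //;
  by rewrite !inE eqxx.
Qed.

Lemma eq_arcs e e' A : {in A &, e =2 e'} -> arcs e A = arcs e' A.
Proof.
move=> ee'; apply: eq_bigr => x xA; rewrite !degE.
by apply: eq_bigr => y yA; rewrite ee'.
Qed.

(** Inclusion-exclusion along the separator [C]. *)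
Lemma arcs_glue e X C Y : symmetric e -> [disjoint X & C] -> [disjoint X & Y] ->
  [disjoint C & Y] -> cross e X Y = 0 ->
  arcs e (X :|: C :|: Y) + arcs e C = arcs e (X :|: C) + arcs e (C :|: Y).
Proof.
move=> es dXC dXY dCY e0.
have dd : [disjoint X :|: C & Y] by rewrite -setI_eq0 setIUl setU_eq0 !setI_eq0 dXY.
by rewrite !arcsU // crossUl // e0; lia.
Qed.

Lemma arcs_leq_sq e A : arcs e A <= #|A| ^ 2.
Proof.
rewrite -mulnn -sum_nat_const; apply: leq_sum => x _.
by apply: subset_leq_card; apply/subsetP => y; rewrite inE => /andP[].
Qed.

Lemma exists_deg_le e A k : arcs e A < k.+1 * #|A| ->
  exists2 x, x \in A & deg e A x <= k.
Proof.
move=> small; apply/exists_inP; apply: contraTT small.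
rewrite negb_exists_in -leqNgt => /forall_inP big.
rewrite mulnC -sum_nat_const; apply: leq_sum => x xA.
by rewrite ltnNge big.
Qed.

(** Identifying [b] with [a] destroys the edge [ab], if present, and merges two edges into one at
    each common neighbour; ordered pairs double these losses. *)
Lemma arcs_contract e A a b : symmetric e -> irreflexive e ->
  a \in A -> b \in A -> a != b ->
  arcs e A <= arcs (contract a b e) (A :\ b)
              + 2 * e a b + 2 * #|[set y in A | e a y && e b y]|.
Proof.
move=> es ei aA bA ab; set e' := contract a b e; set B := A :\ b :\ a.
have aAb : a \in A :\ b by rewrite !inE ab.
have e's : symmetric e' by apply: contract_sym.
have e'i : irreflexive e' by apply: contract_irrefl.
have aB : a \notin B by rewrite !inE eqxx.
have bB : b \notin A :\ b by rewrite !inE eqxx.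
have eB : arcs e B = arcs e' B.
  apply: eq_arcs => x y; rewrite !inE /e' /contract => /and3P[/negPf-> _ _].
  by case/and3P => /negPf-> _ _; rewrite /= orbF.
have -> : arcs e A = arcs e B + 2 * deg e B a + 2 * (e b a + deg e B b).
  rewrite -[in LHS](setD1K bA) arcsU1 // -(setD1K aAb) -/B arcsU1 //.
  by rewrite (degU1 e b) // es.
have -> : arcs e' (A :\ b) = arcs e' B + 2 * deg e' B a.
  by rewrite -[in LHS](setD1K aAb) -/B arcsU1.
(* The union of the two neighbourhoods lies in that of the merged vertex, and their intersection
   consists of common neighbours. *)
have : deg e B a + deg e B b <= deg e' B a + #|[set y in A | e a y && e b y]|.
  rewrite /deg -cardsUI leq_add //; apply: subset_leq_card; apply/subsetP => y.
    by rewrite !inE /e' /contract eqxx => /orP[]/andP[/and3P[-> -> ->] ->] /=;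
      rewrite ?orbT.
  by rewrite !inE => /andP[/andP[/and3P[_ _ ->] ->] /andP[_ ->]].
rewrite eB (es b a); lia.
Qed.

(** Deleting one edge lowers the count by one or two, so repeated deletion cannot jump over both [k]
    and [k.+1]. This trims a counterexample until it barely violates a bound. *)
Lemma exists_subrel_arcs e A k : symmetric e -> k <= arcs e A ->
  exists e', [/\ symmetric e', subrel e' e & k <= arcs e' A <= k.+1].
Proof.
have [n] := ubnP (arcs e A); elim: n e => // n IH e le_n es ke.
have [small|big] := leqP (arcs e A) k.+1; first by exists e; split; rewrite ?ke.
have /existsP[x /existsP[y /and3P[xA yA exy]]] :
    [exists x, exists y, [&& x \in A, y \in A & e x y]].
  apply: contraTT big; rewrite negb_exists -leqNgt => /forallP no.
  apply: (@leq_trans 0) => //; rewrite leqn0 /arcs /cross big1 // => x xA.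
  rewrite degE big1 // => y yA; have := no x; rewrite negb_exists.
  by move/forallP/(_ y); rewrite xA yA /=; case: (e x y).
pose f u v := (u == x) && (v == y).
pose e' u v := e u v && ~~ (f u v || f v u).
have e's : symmetric e' by move=> u v; rewrite /e' es orbC.
have e'e : subrel e' e by move=> u v /andP[].
have sumf u0 v0 : u0 \in A -> v0 \in A ->
    \sum_(u in A) \sum_(v in A) ((u == u0) && (v == v0) : nat) = 1.
  move=> uA vA; rewrite (bigD1 u0) //= (bigD1 v0) //= !eqxx big1 ?big1 //.
    by move=> u /andP[_ /negPf->]; rewrite big1.
  by move=> v /andP[_ /negPf->].
have le2 : arcs e A <= arcs e' A + 2.
  have -> : 2 = \sum_(u in A) \sum_(v in A) f u v + \sum_(u in A) \sum_(v in A) f v u.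
    rewrite sumf // exchange_big sumf //.
  rewrite addnA -!big_split /=; apply: leq_sum => u uA.
  rewrite !degE -!big_split /=; apply: leq_sum => v vA.
  by rewrite /e'; case: (e u v); case: (f u v); case: (f v u).
have lt1 : arcs e' A < arcs e A.
  rewrite /arcs /cross (bigD1 x) //= [ltnRHS](bigD1 x) //=.
  rewrite -addSn leq_add //.
    rewrite !degE (bigD1 y) //= [ltnRHS](bigD1 y) //= -addSn leq_add //.
      by rewrite /e' exy /f !eqxx.
    by apply: leq_sum => v _; rewrite /e'; case: (e x v) => //; case: (~~ _).
  apply: leq_sum => u _; rewrite !degE; apply: leq_sum => v _.
  by rewrite /e'; case: (e u v) => //; case: (~~ _).
have [e'' [? sub ?]] := IH e' (leq_trans lt1 le_n) e's ltac:(lia).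
by exists e''; split => // u v /sub /e'e.
Qed.

End ArcCounting.

(** * Hall's theorem and the bound for planar graphs *)

Section Hall.
Import fintype boot.finset.
Variable T : finType.
Implicit Types (r : rel T) (A B C : {set T}).

Definition nbhd r B := [set y | [exists x in B, r x y]].

Lemma nbhdU r B C : nbhd r (B :|: C) = nbhd r B :|: nbhd r C.
Proof.
apply/setP => y; rewrite !inE; apply/exists_inP/orP.
  case=> x /setUP[xB|xC] rxy; [left|right]; apply/exists_inP; by exists x.
by case=> /exists_inP[x xB rxy]; exists x; rewrite // inE xB ?orbT.
Qed.

(** Induction on the size of [A]. If a nonempty proper subset [B] is tight, match [B] first and then
    the rest of [A] outside [nbhd r B], where Hall's condition for [C] follows from that for
    [C :|: B]. Otherwise every nonempty proper subset has slack one, so any [a] may take any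
    neighbour [y]. *)
Lemma hall r A : (forall B, B \subset A -> #|B| <= #|nbhd r B|) ->
  exists f : T -> T, {in A &, injective f} /\ {in A, forall x, r x (f x)}.
Proof.
have [n] := ubnP #|A|; elim: n r A => // n IH r A leAn hallA.
have [->|/set0Pn[a aA]] := eqVneq A set0.
  by exists id; split=> x; rewrite inE.
have [/existsP[B /and3P[BA /set0Pn[b bB] tight]]|/existsPn slack] :=
  boolP [exists B : {set T}, [&& B \proper A, B != set0 & #|nbhd r B| <= #|B|]].
  have [f1 [inj1 r1]] := IH r B (leq_trans (proper_card BA) leAn)
    (fun C CB => hallA C (subset_trans CB (proper_sub BA))).
  pose r' : rel T := fun x y => r x y && (y \notin nbhd r B).
  have cardAB : #|A :\: B| < n.
    rewrite -ltnS; apply: leq_trans leAn; rewrite ltnS.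
    apply/proper_card/properP; split; first exact: subsetDl.
    by exists b; rewrite ?inE ?bB // (subsetP (proper_sub BA)).
  have [|f2 [inj2 r2]] := IH r' _ cardAB.
    move=> C; rewrite subsetD => /andP[CA dCB].
    have := hallA (C :|: B); rewrite subUset CA (proper_sub BA) => /(_ isT).
    rewrite cardsU (disjoint_setI0 dCB) cards0 subn0.
    have -> : nbhd r (C :|: B) = nbhd r' C :|: nbhd r B.
      rewrite nbhdU; apply/setP => y; rewrite 2!in_setU.
      have [|yB] := boolP (y \in nbhd r B); first by rewrite !orbT.
      rewrite !orbF !inE; apply: eq_existsb => x.
      by rewrite /r' yB andbT.
    move/leq_trans/(_ (leq_card_setU _ _)); lia.
  exists (fun x => if x \in B then f1 x else f2 x).
  have sep x y : x \in B -> y \in A -> y \notin B -> f1 x != f2 y.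
    move=> xB yA yB; have /andP[_] : r' y (f2 y) by apply: r2; rewrite inE yB.
    apply: contraNneq => <-; rewrite inE; apply/exists_inP; exists x => //.
    exact: r1.
  split=> [x y xA yA|x xA].
    case: ifPn => xB; case: ifPn => yB fxy.
    - exact: inj1.
    - by move: (sep x y xB yA yB); rewrite fxy eqxx.
    - by move: (sep y x yB xA xB); rewrite fxy eqxx.
    - by apply: inj2; rewrite // inE ?xB ?yB.
  case: ifPn => xB; first exact: r1.
  by have /andP[] : r' x (f2 x) by apply: r2; rewrite inE xB.
have : 0 < #|nbhd r [set a]|.
  by apply: leq_trans (hallA [set a] _); rewrite ?cards1 // sub1set.
case/card_gt0P => y; rewrite inE => /exists_inP[a' /set1P-> ray].
pose r' : rel T := fun x z => r x z && (z != y).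
have [||f [injf rf]] := IH r' (A :\ a).
- by move: leAn; rewrite (cardsD1 a A) aA.
- move=> C CA; have [->|C0] := eqVneq C set0; first by rewrite cards0.
  have CpA : C \proper A.
    apply/properP; split; first exact: subset_trans CA (subsetDl _ _).
    by exists a => //; apply: contraTN CA => aC; apply/subsetPn; exists a; rewrite // !inE eqxx.
  have := slack C; rewrite CpA C0 /= -ltnNge => /leq_trans.
  have -> : nbhd r' C = nbhd r C :\ y.
    apply/setP => z; rewrite !inE; apply/exists_inP/andP.
      case=> x xC /andP[rxz zy]; split => //; apply/exists_inP; by exists x.
    by case=> zy /exists_inP[x xC rxz]; exists x => //; rewrite /r' rxz.
  by rewrite (cardsD1 y (nbhd r C)) => /(_ _ (leqnn _)); case: (y \in _); lia.
exists (fun x => if x == a then y else f x).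
have fy x : x \in A -> x != a -> f x != y.
  by move=> xA xa; have /andP[] : r' x (f x) by apply: rf; rewrite !inE xa.
split=> [x z xA zA|x xA].
  case: eqVneq => [->|xa]; case: eqVneq => [->|za] //.
  - by move=> yf; move: (fy z zA za); rewrite -yf eqxx.
  - by move=> yf; move: (fy x xA xa); rewrite yf eqxx.
  - by apply: injf; rewrite !inE ?xa ?za.
case: eqVneq => [->//|xa].
by have /andP[] : r' x (f x) by apply: rf; rewrite !inE xa.
Qed.

End Hall.

Section PlanarBounds.
Import fintype boot.finset.
Variables (V : finType) (h : rel V).
Hypothesis h_anti : forall x y, x != y -> h x y = ~~ h y x.
Implicit Types (A B C X : {set V}) (e : rel V).

Lemma z2planar_K5 A e (s : seq V) : z2planar h A e ->
  size s = 5 -> uniq s -> {subset s <= A} -> pairwise e s -> False.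
Proof.
move=> [W HW] s5 us sA ps.
have x0 : V by case: s s5 {us sA ps} => [|x].
have es i j : i < j < 5 -> e (nth x0 s i) (nth x0 s j).
  move=> ij; move/(pairwiseP x0): ps; apply; rewrite ?inE ?s5; lia.
have ns i j : i < 5 -> j < 5 -> i != j -> nth x0 s i != nth x0 s j.
  by move=> i5 j5 ij; rewrite nth_uniq ?s5.
apply: (@K5_not_bal _ h h_anti (nth x0 s) (fun i j => W (nth x0 s i) (nth x0 s j))).
  by move=> i j ij; apply: ns; lia.
move=> i j k l ij kl ik jk jl.
by apply: HW; try (apply: sA; apply: mem_nth; rewrite s5; lia);
  try (apply: es; lia); apply: ns; lia.
Qed.

Lemma clique_pairwise e (s : seq V) : uniq s ->
  {in s &, forall x y, x != y -> e x y} -> pairwise e s.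
Proof.
elim: s => //= x s IH /andP[xs us] es; rewrite IH //; last first.
  by move=> y z ys zs; apply: es; rewrite inE ?ys ?zs orbT.
rewrite andbT; apply/allP => y ys; apply: es; rewrite ?inE ?eqxx ?ys ?orbT //.
by apply: contraNneq xs => ->.
Qed.

(* In a minimal counterexample some vertex u has degree at most 5, and each edge at
   u lies in three triangles, since contracting it would lose at most three edges
   otherwise; then u and its neighbours have a K_5 minor. *)
Lemma arcs_z2planar A e : symmetric e -> irreflexive e -> 0 < #|A| ->
  z2planar h A e -> arcs e A + 3 <= 6 * #|A|.
Proof.
have [n] := ubnP #|A|; elim: n A e => // n IH A e0 leAn es0 ei0 A0 P0.
rewrite leqNgt; apply/negP => big.
(* [6 * #|A| - 2] is the least value violating the bound. After trimming, the average degree is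
   still below 6. *)
have [|e [es sub /andP[ge le]]] := @exists_subrel_arcs _ e0 A (6 * #|A| - 2) es0.
  by lia.
have ei : irreflexive e by move=> x; apply: contraFF (ei0 x) => /sub.
have P : z2planar h A e by apply: z2planarW P0.
move: {e0 es0 ei0 P0 big sub} ge le => ge le.
have A1 : 1 < #|A|.
  rewrite ltn_neqAle A0 andbT eq_sym; apply/eqP => cA.
  have /cards1P[x Ax] : #|A| == 1 by rewrite cA.
  by move: ge; rewrite Ax arcs1 // cards1.
have [u uA du] : exists2 u, u \in A & deg e A u <= 5.
  by apply: exists_deg_le; lia.
have cD1 x : x \in A -> #|A| = #|A :\ x|.+1.
  by move=> xA; rewrite (cardsD1 x A) xA.
have du4 : 3 < deg e A u.
  rewrite ltnNge; apply/negP => du3.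
  have := IH (A :\ u) e; rewrite (arcsD1 es ei uA) (cD1 _ uA) in leAn A1 ge *.
  move/(_ leAn es ei).
  have -> : 0 < #|A :\ u| by lia.
  have P' : z2planar h (A :\ u) e by apply: z2planarW P; rewrite ?subsetDl.
  by move/(_ isT P'); lia.
pose K := [set y in A | e u y].
have common v : v \in K -> 2 < #|[set y in K | e v y]|.
  rewrite inE => /andP[vA euv]; rewrite ltnNge; apply/negP => le2.
  have uv : u != v by apply: contraTneq euv => ->; rewrite ei.
  have P' : z2planar h (A :\ v) (contract u v e).
    apply: (@z2planar_contract _ _ h_anti A (A :\ v) e u [:: v]) => //=.
    - by rewrite euv.
    - by move=> z; rewrite inE => /eqP->.
    - exact: subsetDl.
    - by rewrite !inE uv.
    - by move=> x; rewrite !inE => /andP[].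
  have := IH (A :\ v) (contract u v e); rewrite (cD1 _ vA) in leAn A1 ge *.
  move/(_ leAn (contract_sym _ _ es) (contract_irrefl _ _ ei)).
  have -> : 0 < #|A :\ v| by lia.
  move/(_ isT P'); have := arcs_contract es ei uA vA uv.
  have -> : [set y in A | e u y && e v y] = [set y in K | e v y].
    by apply/setP => y; rewrite !inE andbA.
  by case: (e u v); lia.
have KA v : v \in K -> v \in A by rewrite inE => /andP[].
have uK v : v \in K -> e u v by rewrite inE => /andP[].
have neqK v : v \in K -> u != v.
  by move/uK; apply: contraTneq => ->; rewrite ei.
have cK : 3 < #|K| <= 5 by rewrite du4 du.
(* If the neighbours of [u] form a clique, [u] and four of them are already a K_5. *)
have [clq|] := boolP [forall v in K, forall w in K, (v != w) ==> e v w].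
  have sK : {subset take 4 (enum K) <= K}.
    by move=> z /mem_take; rewrite mem_enum.
  apply: (@z2planar_K5 A e (u :: take 4 (enum K))) => //.
  - rewrite /= size_takel // -cardE; lia.
  - rewrite cons_uniq take_uniq ?enum_uniq // andbT.
    by apply/negP => /sK /neqK; rewrite eqxx.
  - by move=> z; rewrite inE => /predU1P[->//|/sK/KA].
  rewrite /=; apply/andP; split; first by apply/allP => z /sK /uK.
  apply: clique_pairwise; first by rewrite take_uniq ?enum_uniq.
  move=> x y /sK xK /sK yK; move/forall_inP: clq => /(_ _ xK).
  by move/forall_inP/(_ _ yK)/implyP.
case/forall_inPn => v vK /forall_inPn[w wK]; rewrite negb_imply => /andP[vw nvw].
(* A vertex of [K] has at least three neighbours among at most four other vertices of [K], hence at
   most one non-neighbour there. *)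
have nonadj x y z : x \in K -> y \in K -> z \in K ->
    x != y -> x != z -> y != z -> ~~ e x y -> e x z.
  move=> xK yK zK xy xz yz nxy; apply: contraT => nxz.
  have := common _ xK; rewrite ltnNge => /negP[].
  have /leq_trans : #|[set t in K | e x t]| <= #|K :\ x :\ y :\ z|.
    apply/subset_leq_card/subsetP => t; rewrite !inE => /andP[-> ext].
    by rewrite andbT; apply/and3P; split; apply: contraTneq ext => ->; rewrite ?ei.
  apply; have [_ le5] := andP cK; rewrite -(leq_add2l 3); apply: leq_trans le5.
  rewrite (cardsD1 x K) xK (cardsD1 y (K :\ x)) (cardsD1 z (K :\ x :\ y)).
  by rewrite !in_setD1 zK yK !(eq_sym y) !(eq_sym z) xy xz yz.
pose R := K :\ v :\ w.
have cR : #|K| = #|R|.+2.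
  by rewrite (cardsD1 v K) vK (cardsD1 w (K :\ v)) in_setD1 wK eq_sym vw.
have RK x : x \in R -> [/\ x \in K, e v x, e w x, x != v & x != w].
  rewrite 2!in_setD1 => /and3P[xw xv xK]; split=> //.
    by apply: (nonadj v w); rewrite // eq_sym.
  by apply: (nonadj w v); rewrite // 1?eq_sym // es.
(* Of three vertices in [R], if [x] and [y] are not adjacent, then [x] and [z] are. *)
have [x [y [z [xR yR zR [xy xz yz] exy]]]] : exists x y z,
    [/\ x \in R, y \in R, z \in R, [/\ x != y, x != z & y != z] & e x y].
  have : 2 < #|R|.
    suff -> : R = [set y in K | e v y] by apply: common.
    apply/setP => y; apply/idP/idP => [/RK[yK evy _ _ _]|]; first by rewrite inE yK.
    rewrite inE => /andP[yK evy]; rewrite in_setD1 in_setD1 yK andbT.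
    by apply/andP; split; apply: contraTneq evy => ->; rewrite ?ei.
  case/card_gt2P => x [y [z [[xR yR zR] [xy yz zx]]]].
  have [exy|nxy] := boolP (e x y); first by exists x, y, z; rewrite (eq_sym x z).
  exists x, z, y; rewrite (eq_sym x z) (eq_sym z y); split=> //.
  have [[xK _ _ _ _] [yK _ _ _ _]] := (RK x xR, RK y yR).
  have [zK _ _ _ _] := RK z zR.
  by apply: (nonadj x y); rewrite // eq_sym.
have [[xK evx ewx xv xw] [yK evy ewy yv yw]] := (RK x xR, RK y yR).
have [zK evz ewz zv zw] := RK z zR.
(* Since [z] is adjacent to both [v] and [w], contracting it into [v] supplies the missing edge
   [vw]. *)
apply: (@z2planar_K5 (A :\ z) (contract v z e) [:: u; v; w; x; y]) => //.
- apply: (@z2planar_contract _ _ h_anti A (A :\ z) e v [:: z]) => //=.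
  + by rewrite evz.
  + by move=> t; rewrite inE => /eqP->; apply: KA.
  + exact: subsetDl.
  + by rewrite in_setD1 eq_sym zv KA.
  + by move=> t; rewrite !inE => /andP[].
- rewrite /= !inE !negb_or !neqK // vw !(eq_sym v) !(eq_sym w) xv xw yv yw xy.
  by [].
- move=> t; rewrite in_setD1 !in_cons in_nil orbF.
  by case/or4P => [/eqP->|/eqP->|/eqP->|/orP[/eqP->|/eqP->]];
    rewrite ?(KA _ vK) ?(KA _ wK) ?(KA _ xK) ?(KA _ yK) ?uA ?(neqK _ zK) ?xz ?yz //
      andbT eq_sym.
- rewrite /= /contract !uK // evx evy ewx ewy exy eqxx (eq_sym w) vw (es z w) ewz.
  by rewrite !orbT.
Qed.

End PlanarBounds.

(** * The bound for bipartite planar graphs *)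

Section BipartiteBound.
Import fintype boot.finset.
Variables (V : finType) (h : rel V).
Hypothesis h_anti : forall x y, x != y -> h x y = ~~ h y x.
Implicit Types (A B C X : {set V}) (e : rel V).

(** The connected set [X] plays the third vertex and [c] represents it: its edge to [w j] is a walk
    inside [X] with one last step out. Two such walks share the end [c], so the equations only
    compare a walk with a single edge at [a] or [b], or two such edges. *)
Lemma z2planar_K33 A e X a b c (w : nat -> V) :
  z2planar h A e -> X \subset A -> c \in X ->
  a \in A -> b \in A -> a != b -> a \notin X -> b \notin X ->
  (forall j, j < 3 -> [/\ w j \in A, w j \notin X, w j != a & w j != b]) ->
  (forall i j, i < j < 3 -> w i != w j) ->
  (forall j, j < 3 -> e a (w j) /\ e b (w j)) ->
  (forall j, j < 3 -> exists p,
     [/\ path e c p, {subset c :: p <= X} & e (last c p) (w j)]) ->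
  False.
Proof.
move=> [W HW] /subsetP XA cX aA bA ab aX bX wA w_neq ew connX.
have [p0 [pp0 p0X ep0]] := connX 0 isT.
have [p1 [pp1 p1X ep1]] := connX 1 isT.
have [p2 [pp2 p2X ep2]] := connX 2 isT.
pose pw j := rcons (nth [::] [:: p0; p1; p2] j) (w j).
have pwP j : j < 3 -> [/\ path e c (pw j), {subset c :: pw j <= A},
    last c (pw j) = w j & {subset c :: pw j <= w j |: X}].
  have base p : path e c p -> {subset c :: p <= X} -> e (last c p) (w j) -> j < 3 ->
      [/\ path e c (rcons p (w j)), {subset c :: rcons p (w j) <= A},
      last c (rcons p (w j)) = w j & {subset c :: rcons p (w j) <= w j |: X}].
    move=> pp pX ep j3; have [wjA _ _ _] := wA j j3; rewrite rcons_path pp ep last_rcons.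
    split=> // z; rewrite -rcons_cons mem_rcons in_cons => /predU1P[->//|/pX zX].
    - exact: XA.
    - by rewrite setU11.
    - by rewrite in_setU1 zX orbT.
  by case: j base => [|[|[|]]] // base _; apply: base.
pose u i := nth c [:: a; b] i.
pose E i j := if i < 2 then W (u i) (w j) else walk_parity W c (pw j).
apply: (@K33_not_bal _ h h_anti u w E w_neq) => i i' j j' ii' j3 j'3 jj'.
have jw : w j != w j'.
  have [jj|jj|/eqP] := ltngtP j j'; last by rewrite (negPf jj').
  - by apply: w_neq; rewrite jj.
  - by rewrite eq_sym; apply: w_neq; rewrite jj.
have i2 : i < 2 by case/andP: ii' => ii' i'3; apply: leq_trans ii' i'3.
have [uA uX ue uw] : [/\ u i \in A, u i \notin X, forall k, k < 3 -> e (u i) (w k) &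
    forall k, k < 3 -> u i != w k].
  rewrite /u; case: i i2 {ii'} => [|[|]] //= _; split=> // k k3.
  - by have [] := ew k k3.
  - by have [_ _ ] := wA k k3; rewrite eq_sym.
  - by have [] := ew k k3.
  - by have [_ _ _] := wA k k3; rewrite eq_sym.
have [wjA wjX _ _] := wA j j3; have [wj'A wj'X wj'a wj'b] := wA j' j'3.
rewrite /E i2; case: ifP => i'2.
  have [-> ->] : i = 0 /\ i' = 1 by move: i'2 ii'; clear; lia.
  apply: HW => //; first by have [] := ew j j3.
  - by have [] := ew j' j'3.
  - by rewrite eq_sym.
  - by have [_ _ _] := wA j j3.
have -> : i' = 2 by move: i'2 ii'; clear; lia.
have [pp pA lastp pX] := pwP j' j'3.
have nin z : z \notin X -> z != w j' -> z \notin c :: pw j'.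
  by move=> zX zw; apply/negP => /pX; rewrite in_setU1 (negPf zX) (negPf zw).
have cn z : z \notin X -> c != z by apply: contraNneq => <-.
rewrite (_ : u 2 = c) //.
apply: (balC h_anti); rewrite ?cn //.
- by rewrite eq_sym uw.
- by rewrite eq_sym.
rewrite -[in X in bal _ _ _ X]lastp.
apply: (walk_bal (A := A) (e := e)) => //; last 2 first.
- by apply: nin; rewrite ?uw.
- exact: nin.
move=> y z yA zA eyz *; apply: HW; rewrite ?ue // eq_sym //.
Qed.

(** Sides of sizes [l] and [r] carry at most [l * r] edges, and this is at most 2(l + r) - 4 because
    (l - 2)(r - 2) <= 0 when l + r is 3 or 4. *)
Lemma bipartite_arcs_small A e (side : V -> bool) : symmetric e ->
  (forall x y, e x y -> side x != side y) ->
  2 < #|A| <= 4 -> arcs e A + 8 <= 4 * #|A|.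
Proof.
move=> es bip cA; pose L := [set x in A | side x]; pose R := [set x in A | ~~ side x].
have arcs0 B (s : bool) : {in B, forall x, side x = s} -> arcs e B = 0.
  move=> Bs; rewrite /arcs /cross big1 // => x xB; rewrite degE big1 // => y yB.
  by case: (boolP (e x y)) => // /bip; rewrite !Bs // eqxx.
have dLR : [disjoint L & R].
  by rewrite -setI_eq0; apply/eqP/setP => x; rewrite !inE; case: (side x); rewrite ?andbF.
have ALR : A = L :|: R.
  by apply/setP => x; rewrite !inE; case: (side x); rewrite ?andbT ?andbF ?orbF.
have cLR : cross e L R <= #|L| * #|R|.
  rewrite -sum_nat_const; apply: leq_sum => x _.
  by apply: subset_leq_card; apply/subsetP => y; rewrite inE => /andP[].
move: cA; rewrite {}ALR arcsU // cardsU (disjoint_setI0 dLR) cards0 subn0.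
rewrite (arcs0 L true) ?(arcs0 R false); first last.
- by move=> x; rewrite inE => /andP[].
- by move=> x; rewrite inE => /andP[_ /negPf].
move: cLR; move: (#|L|) (#|R|) (cross e L R) => l r c; clear.
(* Fixing [l] makes the product linear. *)
by case: l => [|[|[|[|[|l]]]]]; lia.
Qed.

(** A 4-cycle attains the bipartite bound with equality, which is why gluing along it preserves the
    bound. *)
Lemma arcs_C4 e (side : V -> bool) a b s p : symmetric e ->
  (forall x y, e x y -> side x != side y) ->
  a != b -> s != p -> e s a -> e s b -> e p a -> e p b ->
  arcs e (a |: (b |: (s |: [set p]))) = 8.
Proof.
move=> es bip ab sp sa sb pa pb.
have ei : irreflexive e by move=> x; apply/negP => /bip; rewrite eqxx.
have nab : e a b = false.
  apply/negP => /bip; move: (bip _ _ sa) (bip _ _ sb).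
  by case: (side a); case: (side b); case: (side s).
have nsp : e s p = false.
  apply/negP => /bip; move: (bip _ _ sa) (bip _ _ pa).
  by case: (side a); case: (side p); case: (side s).
have neq x y : e x y -> x != y by apply: contraTneq => ->; rewrite ei.
rewrite !arcsU1 ?arcs1 ?inE ?degU1 // ?inE //.
- have d1 x : deg e [set p] x = e x p by rewrite degE big_set1.
  by rewrite !d1 nsp nab !(es a) !(es b) sa sb pa pb.
- by rewrite negb_or !(eq_sym b) !neq.
- by rewrite negb_or !(eq_sym b) !neq.
- by rewrite !negb_or ab !(eq_sym a) !neq.
Qed.

(* In a minimal counterexample some vertex s has exactly three neighbours a, b, c,
   and a, b have two further common neighbours p1, p2: otherwise contract a-s-b.
   The component X of c in the rest touches p1 and p2, because an untouched one
   would let the graph split along a 4-cycle, where the bound adds up. So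
   {a, b, X} and {s, p1, p2} form a K_{3,3} minor. *)
Lemma bipartite_arcs_z2planar A e (side : V -> bool) : symmetric e ->
  (forall x y, e x y -> side x != side y) -> 2 < #|A| ->
  z2planar h A e -> arcs e A + 8 <= 4 * #|A|.
Proof.
have [n] := ubnP #|A|; elim: n A e => // n IH A e0 leAn es0 bip0 A2 P0.
have [A4|A5] := leqP #|A| 4.
  by apply: bipartite_arcs_small bip0 _ => //; rewrite A2.
rewrite leqNgt; apply/negP => big.
(* [4 * #|A| - 7] is the least value violating the bound. After trimming, the average degree is
   still below 4. *)
have [|e [es sub /andP[ge le]]] := @exists_subrel_arcs _ e0 A (4 * #|A| - 7) es0.
  by lia.
have bip x y : e x y -> side x != side y by move/sub/bip0.
have P : z2planar h A e by apply: z2planarW P0.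
move: {e0 es0 bip0 P0 big sub} ge le => ge le.
have ei : irreflexive e by move=> x; apply/negP => /bip; rewrite eqxx.
have neq x y : e x y -> x != y by apply: contraTneq => ->; rewrite ei.
have cD1 x B : x \in B -> #|B| = #|B :\ x|.+1.
  by move=> xB; rewrite (cardsD1 x B) xB.
have [s sA ds] : exists2 s, s \in A & deg e A s <= 3.
  by apply: exists_deg_le; lia.
have ds2 : 2 < deg e A s.
  rewrite ltnNge; apply/negP => ds2.
  have := IH (A :\ s) e; rewrite (arcsD1 es ei sA) (cD1 _ _ sA) in leAn A2 A5 ge *.
  move/(_ leAn es bip).
  have -> : 2 < #|A :\ s| by lia.
  have P' : z2planar h (A :\ s) e by apply: z2planarW P; rewrite ?subsetDl.
  by move/(_ isT P'); lia.
have /card_gt2P[a [b [c [[]]]]] := ds2; rewrite !inE.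
move=> /andP[aA sa] /andP[bA sb] /andP[cA sc] [ab bc ca].
have sab : side a = side b.
  by move: (bip _ _ sa) (bip _ _ sb); case: (side s); case: (side a); case: (side b).
have nab : e a b = false by apply/negP => /bip; rewrite sab eqxx.
have sAa : a \in A :\ s by rewrite !inE aA eq_sym neq.
have sAb : b \in A :\ s by rewrite !inE bA eq_sym neq.
set Q := [set y in A :\ s | e a y && e b y].
(* Otherwise delete [s], losing at most 6 ordered pairs, and merge the nonadjacent [a] and [b],
   losing at most 2 more. Two vertices fewer lower the bound by 8, which contradicts minimality. *)
have Q2 : 1 < #|Q|.
  rewrite ltnNge; apply/negP => Q1.
  have P' : z2planar h (A :\ s :\ b) (contract a b e).
    apply: (@z2planar_contract _ _ h_anti A (A :\ s :\ b) e a [:: s; b]) => //=.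
    - by rewrite es sa sb.
    - by move=> z; rewrite !inE => /orP[]/eqP->.
    - by apply: subset_trans (subsetDl _ _) (subsetDl _ _).
    - by rewrite in_setD1 sAa ab.
    - by move=> x; rewrite !inE negb_or => /and3P[-> ->].
  have bip' x y : contract a b e x y -> side x != side y.
    case/or3P => [/bip//|/and3P[/eqP-> _ /bip]|/and3P[/eqP-> _ /bip]];
    by rewrite -sab.
  have := IH (A :\ s :\ b) (contract a b e); rewrite (cD1 _ _ sA) (cD1 _ _ sAb) in leAn A2 A5 ge *.
  have lt1 : #|A :\ s :\ b| < n by move: leAn; clear; lia.
  have lt2 : 2 < #|A :\ s :\ b| by move: A5; clear; lia.
  move/(_ lt1 (contract_sym _ _ es) bip' lt2 P').
  have := arcs_contract es ei sAa sAb ab; rewrite -/Q nab.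
  by move: ge Q1 ds; rewrite (arcsD1 es ei sA); clear; lia.
have /card_gt1P[p1 [p2 [p1Q p2Q p12]]] := Q2.
have Qp p : p \in Q -> [/\ p \in A, p != s, e p a & e p b].
  by rewrite !inE => /and3P[/andP[ps pA] ap bp]; rewrite ps pA !(es p).
have [p1A p1s p1a p1b] := Qp _ p1Q; have [p2A p2s p2a p2b] := Qp _ p2Q.
pose F := [set a; b; s; p1; p2].
pose r x y := [&& e x y, x \notin F, y \notin F, x \in A & y \in A].
pose X := [set x | connect r c x].
have sp p : e p a -> side p = side s.
  move=> pa; move: (bip _ _ sa) (bip _ _ pa).
  by case: (side s); case: (side a); case: (side p).
have sFc p : side p = side s -> c != p.
  by move=> pss; apply: contraTneq (bip _ _ sc) => ->; rewrite pss eqxx.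
have cF : c \notin F.
  by rewrite !inE !negb_or ca (eq_sym c b) bc !sFc // sp.
have cX : c \in X by rewrite inE.
have XF x : x \in X -> x \notin F /\ x \in A.
  rewrite inE => /connectP[p]; elim/last_ind: p x => [|p z _] x /=; first by move=> _ ->.
  by rewrite rcons_path last_rcons => /andP[_ /and5P[_ _ ? _ ?]] ->.
have Xclosed x y : x \in X -> e x y -> y \notin F -> y \in A -> y \in X.
  move=> xX exy yF yA; have [xF xA] := XF x xX.
  have rxy : connect r x y by apply: connect1; rewrite /r exy xF yF xA yA.
  by move: xX; rewrite !in_set => xX; apply: connect_trans rxy.
have XA : X \subset A by apply/subsetP => x /XF[].
have touch p q : p \in Q -> q \in Q -> p != q -> F = [set a; b; s; p; q] ->
    exists2 x, x \in X & e x q.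
  move=> pQ qQ pq FE; apply/exists_inP; apply: contraT.
  rewrite negb_exists_in => /forall_inP noq.
  have [pA ps pa pb] := Qp _ pQ; have [qA qs qa qb] := Qp _ qQ.
  (* [C] is the 4-cycle through [a], [s], [b], [p]. If [q] has no neighbour in [X], it falls into
     [Y] and [C] separates [X] from [Y]. *)
  pose C := a |: (b |: (s |: [set p])); pose Y := A :\: (X :|: C).
  have inF x : (x \in F) = (x \in C) || (x == q).
    by rewrite FE !inE; case: (x == a); case: (x == b); case: (x == s);
      case: (x == p).
  have CA : C \subset A by rewrite !subUset !sub1set aA bA sA.
  have qC : q \notin C.
    by rewrite !inE !negb_or (neq _ _ qa) (neq _ _ qb) qs eq_sym.
  have dXC : [disjoint X & C].
    rewrite -setI_eq0; apply/eqP/setP => x; rewrite in_setI in_set0.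
    by apply/negP => /andP[/XF[+ _] xC]; rewrite inF xC.
  have dXY : [disjoint X & Y].
    rewrite -setI_eq0; apply/eqP/setP => x; rewrite in_setI in_set0 in_setD in_setU.
    by case: (x \in X).
  have dCY : [disjoint C & Y].
    rewrite -setI_eq0; apply/eqP/setP => x; rewrite in_setI in_set0 in_setD in_setU.
    by case: (x \in C); rewrite ?orbT.
  have AE : X :|: C :|: Y = A.
    apply/setP => x; rewrite in_setU in_setD in_setU.
    case: (boolP (x \in A)) => [_|xA]; first by rewrite andbT orbN.
    apply/negP; rewrite andbF orbF => /orP[]; [move/(subsetP XA)|move/(subsetP CA)];
      by rewrite (negPf xA).
  have XY0 : cross e X Y = 0.
    rewrite /cross big1 // => x xX; rewrite degE big1 // => y.
    rewrite in_setD in_setU negb_or => /andP[/andP[yX yC] yA].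
    case: (boolP (e x y)) => // exy; case: (eqVneq y q) => [yq|yq].
      by move: exy; rewrite yq (negPf (noq x xX)).
    by move: yX; rewrite (Xclosed x y xX exy) // inF negb_or yC yq.
  have C8 : arcs e C = 8 by apply: arcs_C4 bip _ _ _ _ _ _; rewrite // eq_sym.
  have cC : #|C| = 4.
    rewrite !cardsU1 cards1 !inE !negb_or ab (eq_sym s) ps.
    by rewrite !(eq_sym a) !(eq_sym b) !neq.
  have := arcs_glue es dXC dXY dCY XY0; rewrite AE C8.
  have cXY : #|A| = #|X| + 4 + #|Y|.
    rewrite -AE cardsU (_ : (X :|: C) :&: Y = set0).
      by rewrite cards0 subn0 cardsU (disjoint_setI0 dXC) cards0 subn0 cC.
    by rewrite setIUl (disjoint_setI0 dXY) (disjoint_setI0 dCY) setU0.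
  have cXC : #|X :|: C| = #|X| + 4.
    by rewrite cardsU (disjoint_setI0 dXC) cards0 subn0 cC.
  have cCY : #|C :|: Y| = 4 + #|Y|.
    by rewrite cardsU (disjoint_setI0 dCY) cards0 subn0 cC.
  have X0 : 0 < #|X| by apply/card_gt0P; exists c.
  have Y0 : 0 < #|Y|.
    apply/card_gt0P; exists q; rewrite in_setD in_setU negb_or qC qA !andbT.
    by apply/negP => /XF[+ _]; rewrite inF eqxx orbT.
  have P1 : z2planar h (X :|: C) e.
    by apply: z2planarW P; rewrite // -AE subsetUl.
  have P2 : z2planar h (C :|: Y) e.
    by apply: z2planarW P; rewrite // -AE -setUA subsetUr.
  (* The two parts have [#|A| + 4] vertices in total. Adding their bounds and subtracting the 8
     pairs of [C] gives 4(#|A| + 4) - 16 - 8, the bound for [A]. *)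
  have := IH (X :|: C) e; have := IH (C :|: Y) e; rewrite cXC cCY.
  have lt1 : #|X| + 4 < n by move: leAn Y0; rewrite cXY; clear; lia.
  have lt2 : 4 + #|Y| < n by move: leAn X0; rewrite cXY; clear; lia.
  have lt3 : 2 < #|X| + 4 by rewrite addnC.
  have lt4 : 2 < 4 + #|Y| by [].
  move=> /(_ lt2 es bip lt4 P2) H2 /(_ lt1 es bip lt3 P1) H1 E.
  by move: H1 H2 E ge; rewrite cXY; clear; lia.
have [x1 x1X x1p] : exists2 x, x \in X & e x p1.
  apply: (touch p2) => //; first by rewrite eq_sym.
  by apply/setP => x; rewrite !inE -!orbA; congr [|| _, _, _ | _]; rewrite orbC.
have [x2 x2X x2p] : exists2 x, x \in X & e x p2 by apply: (touch p1).
have walk x : x \in X -> exists p, [/\ path e c p, {subset c :: p <= X} & last c p = x].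
  rewrite inE => /connectP[p pp ->]; exists p; split=> //.
    by apply: sub_path pp => y z /andP[].
  move=> z zp; rewrite inE; have := path_connect pp; apply; exact: zp.
have notX x : x \in F -> x \notin X by move=> xF; apply/negP => /XF[]; rewrite xF.
apply: (@z2planar_K33 A e X a b c (nth s [:: s; p1; p2])) => //.
- by apply: notX; rewrite !inE eqxx.
- by apply: notX; rewrite !inE eqxx orbT.
- case=> [|[|[|]]] //= _; rewrite notX ?neq // ?inE ?eqxx ?orbT //.
- by move=> [|[|[|i]]] [|[|[|j]]] // /andP[] // _ _; rewrite //= eq_sym.
- by case=> [|[|[|j]]] //= _; rewrite !(es _ s, es _ p1, es _ p2).
- case=> [|[|[|]]] //= _.
  + by exists [::]; split=> //; [move=> z; rewrite inE => /eqP->|rewrite es].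
  + by have [p [pp pX lp]] := walk _ x1X; exists p; rewrite lp.
  + by have [p [pp pX lp]] := walk _ x2X; exists p; rewrite lp.
Qed.

End BipartiteBound.

(** * The matching *)

Section DisjointEdges.
Import fintype boot.finset.
Variables (V : finType).
Implicit Types (A B C S U W : {set V}) (e : rel V).

(** Both Hall conditions express that |S| - |N(S)| is maximal. For [T] inside [U], compare [S] with
    [S] minus the neighbours of [T]; for [B] in the remainder, compare [S] with [S :|: B]. *)
Lemma deficiency_decomposition e : symmetric e -> exists S U : {set V},
  [/\ [disjoint S & U], nbhd e S = U,
    exists f, {in U &, injective f} /\ {in U, forall x, e x (f x) && (f x \in S)} &
    exists f, {in ~: (S :|: U) &, injective f} /\
      {in ~: (S :|: U), forall x, e x (f x) && (f x \in ~: (S :|: U))}].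
Proof.
(* Counting the complement of the neighbourhood shifts |S| - |N(S)| by [#|V|] and avoids subtraction
   in the naturals. *)
move=> es; pose excess S := #|S| + #|~: nbhd e S|.
have [S0 _ S0max] := @arg_maxnP {set V} set0 xpredT excess isT.
pose S := S0 :\: nbhd e S0; pose U := nbhd e S.
have inS x : x \in S = (x \notin nbhd e S0) && (x \in S0) by rewrite in_setD.
have indep x y : x \in S -> e x y -> y \notin S.
  rewrite inS => /andP[xN xS0] exy; apply: contra xN.
  rewrite inS => /andP[_ yS0]; rewrite inE; apply/exists_inP; exists y => //.
  by rewrite es.
have US0 : U \subset nbhd e S0 :\: S0.
  apply/subsetP => y; rewrite inE => /exists_inP[x + exy]; rewrite inS => /andP[xN xS0].
  rewrite in_setD; apply/andP; split.
    apply: contra xN => yS0; rewrite inE; apply/exists_inP; exists y => //.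
    by rewrite es.
  by rewrite inE; apply/exists_inP; exists x.
(* Passing from [S0] to [S] removes [#|S0 :&: nbhd e S0|] vertices from the set and at least as many
   from its neighbourhood. *)
have Smax T : excess T <= excess S.
  apply: leq_trans (S0max T isT) _; rewrite /excess -/U.
  have := subset_leq_card US0.
  have := cardsID (nbhd e S0) S0; have := cardsID S0 (nbhd e S0).
  rewrite -/S (setIC (nbhd e S0)); have := cardsC U; have := cardsC (nbhd e S0).
  clear; lia.
exists S, U; split=> //.
- rewrite -setI_eq0; apply/eqP/setP => y; rewrite !in_setI in_set0.
  apply/negP => /andP[yS]; rewrite inE => /exists_inP[x xS exy].
  by move: (indep x y xS exy); rewrite yS.
- pose r : rel V := fun x y => e x y && (y \in S).
  apply: (@hall _ r U) => T TU.
  have := Smax (S :\: nbhd r T); rewrite /excess -/U.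
  have : nbhd e (S :\: nbhd r T) \subset U :\: T.
    apply/subsetP => y; rewrite inE => /exists_inP[x + exy]; rewrite (in_setD _ _ x) => /andP[xN xS].
    rewrite in_setD; apply/andP; split.
      apply: contra xN => yT; rewrite inE; apply/exists_inP; exists y => //.
      by rewrite /r es exy.
    by rewrite inE; apply/exists_inP; exists x.
  move/subset_leq_card; rewrite (cardsD U) (setIidPr TU).
  have : nbhd r T \subset S.
    by apply/subsetP => y; rewrite inE => /exists_inP[x _ /andP[]].
  move=> NS; have := subset_leq_card NS; have := subset_leq_card TU.
  rewrite cardsD (setIidPr NS).
  have := cardsC U; have := cardsC (nbhd e (S :\: nbhd r T)).
  clear; lia.
pose W := ~: (S :|: U); pose r : rel V := fun x y => e x y && (y \in W).
apply: (@hall _ r W) => B BW.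
have dSB : S :&: B = set0.
  apply/setP => x; rewrite in_setI in_set0; apply/negP => /andP[xS xB].
  by have := subsetP BW x xB; rewrite in_setC in_setU xS.
have := Smax (S :|: B); rewrite /excess -/U cardsU dSB cards0 subn0.
have : nbhd e (S :|: B) \subset U :|: nbhd r B.
  rewrite nbhdU subUset subsetUl; apply/subsetP => y; rewrite in_set => /exists_inP[x xB exy].
  rewrite in_setU; case: (boolP (y \in U)) => //= yU.
  rewrite inE; apply/exists_inP; exists x => //; rewrite /r exy in_setC in_setU negb_or yU andbT.
  apply/negP => yS; have := subsetP BW x xB; rewrite in_setC in_setU negb_or => /andP[_].
  by case/negP; rewrite inE; apply/exists_inP; exists y; rewrite // es.
move/subset_leq_card/leq_trans/(_ (leq_card_setU _ _)).
have := cardsC U; have := cardsC (nbhd e (S :|: B)).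
clear; lia.
Qed.

(** Take [I] maximal. A vertex of [W] outside [I], its image and its preimage could be added, so
    these three sets, each of size at most [#|I|], cover [W]. *)
Lemma exists_third_disjoint_image W (f : V -> V) : {in W &, injective f} ->
  {in W, forall x, (f x \in W) && (f x != x)} ->
  exists2 I : {set V}, I \subset W & [disjoint I & f @: I] /\ #|W| <= 3 * #|I|.
Proof.
move=> finj fW.
pose P (I : {set V}) := (I \subset W) && [disjoint I & f @: I].
have [|I /maxsetP[/andP[IW dI] Imax] _] := @maxset_exists _ P set0.
  by rewrite /P sub0set imset0 -setI_eq0 setI0 eqxx.
exists I => //; split=> //.
pose J := [set x in W | f x \in I].
have cJ : #|J| <= #|I|.
  rewrite -(card_in_imset (f := f) (D := J)).
    by apply/subset_leq_card/subsetP => _ /imsetP[x xJ ->]; move: xJ; rewrite inE => /andP[].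
  by move=> x y; rewrite !inE => /andP[xW _] /andP[yW _]; apply: finj.
have cI : #|f @: I| <= #|I| by apply: leq_imset_card.
have : W \subset I :|: f @: I :|: J.
  apply/subsetP => x xW; rewrite !in_setU; apply: contraT; rewrite !negb_or.
  case/andP => /andP[xI xfI] xJ; case/negP: xI.
  rewrite -(Imax (x |: I)) ?subsetUr ?setU11 // /P subUset sub1set xW IW /=.
  rewrite imsetU imset_set1 -setI_eq0; apply/eqP/setP => y.
  rewrite in_setI !in_setU !in_set1 in_set0; apply/negP => /andP[].
  have /andP[_ fxx] := fW x xW.
  case/orP => [/eqP->|yI] /orP[/eqP yx|yfI].
  - by move: fxx; rewrite -yx eqxx.
  - by rewrite yfI in xfI.
  - by move: xJ; rewrite inE xW -yx yI.
  - by have := disjointFr dI yI; rewrite yfI.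
move/subset_leq_card/leq_trans/(_ (leq_card_setU _ _)).
have := leq_of_leqif (leq_card_setU I (f @: I)); move: cJ cI; clear; lia.
Qed.

(** The pairs [x], [g x] are the matching edges. [D] is [U], matched into [S], together with a third
    of the remainder [W], matched within [W]. *)
Lemma z2planar_disjoint_edges (h : rel V) e :
  (forall x y, x != y -> h x y = ~~ h y x) ->
  symmetric e -> irreflexive e -> z2planar h setT e ->
  exists (D : {set V}) (g : V -> V),
    [/\ {in D &, injective g}, {in D, forall x, g x \notin D},
        {in D, forall x, e x (g x)} &
        arcs e setT <= 2 * (2 * #|V| + 3 * #|D|)].
Proof.
move=> ha es ei P.
have [S [U [dSU NSU [f1 [inj1 f1P]] [f2 [inj2 f2P]]]]] := deficiency_decomposition es.
set W := ~: (S :|: U) in inj2 f2P.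
have [|I IW [dI cI]] := exists_third_disjoint_image inj2.
  move=> x xW; have /andP[exf ->] := f2P x xW; apply: contraTneq exf => ->.
  by rewrite ei.
have WP x : (x \in W) = (x \notin S) && (x \notin U) by rewrite in_setC in_setU negb_or.
have IWP x : x \in I -> [/\ x \in W, x \notin S & x \notin U].
  by move=> /(subsetP IW) xW; split=> //; move: xW; rewrite WP => /andP[].
have dUI : [disjoint U & I].
  rewrite -setI_eq0; apply/eqP/setP => x; rewrite in_setI in_set0.
  by apply/negP => /andP[xU /IWP[_ _]]; rewrite xU.
have US x : x \in U -> x \notin S.
  by move=> xU; have /negbT := disjointFl dSU xU.
pose g x := if x \in U then f1 x else f2 x.
have gU x : x \in U -> g x \in S by move=> xU; rewrite /g xU; have /andP[] := f1P x xU.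
have gI x : x \in I -> g x = f2 x /\ g x \in W.
  move=> /IWP[xW _ /negPf xU]; rewrite /g xU; split => //.
  by have /andP[] := f2P x xW.
exists (U :|: I), g; split.
- have sep x y : x \in U -> y \in I -> g x <> g y.
    move=> /gU gxS /gI[_]; rewrite WP => /andP[gyS _] gxy.
    by rewrite -gxy gxS in gyS.
  move=> x y /setUP[xU|xI] /setUP[yU|yI] gxy.
  + by apply: inj1 => //; move: gxy; rewrite /g xU yU.
  + by case: (sep x y xU yI gxy).
  + by case: (sep y x yU xI).
  + have [[gx _] [gy _]] := (gI x xI, gI y yI).
    by apply: inj2; rewrite -?gx -?gy //; have [] := IWP _ xI; have [] := IWP _ yI.
- move=> x /setUP[xU|xI]; rewrite in_setU negb_or.
    have gxS := gU x xU; apply/andP; split.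
      by apply: contraL gxS; apply: US.
    by apply: contraL gxS => /IWP[].
  have [gx gxW] := gI x xI; move: (gxW); rewrite WP => /andP[_ -> /=].
  by rewrite gx; apply/negP => fxI; have := disjointFr dI fxI; rewrite imset_f.
- move=> x /setUP[xU|xI].
    by rewrite /g xU; have /andP[] := f1P x xU.
  by have [-> _] := gI x xI; have [xW _ _] := IWP x xI; have /andP[] := f2P x xW.
have VE : [set: V] = U :|: W :|: S.
  by apply/setP => x; rewrite in_setT !in_setU WP; case: (x \in S); case: (x \in U).
have dUW : [disjoint U & W].
  by rewrite -setI_eq0; apply/eqP/setP => x; rewrite in_setI in_set0 WP; case: (x \in U); rewrite ?andbF.
have dWS : [disjoint W & S].
  by rewrite -setI_eq0; apply/eqP/setP => x; rewrite in_setI in_set0 WP; case: (x \in S); rewrite ?andbF.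
have dUWS : [disjoint U :|: W & S].
  by rewrite -setI_eq0 setIUl (disjoint_setI0 dWS) setU0 setI_eq0 disjoint_sym.
have NS x y : x \in S -> e x y -> y \in U.
  by move=> xS exy; rewrite -NSU inE; apply/exists_inP; exists x.
have arcsS : arcs e S = 0.
  rewrite /arcs /cross big1 // => x xS; rewrite degE big1 // => y yS.
  by case: (boolP (e x y)) => // /(NS x y xS) /US; rewrite yS.
have crossWS : cross e W S = 0.
  rewrite /cross big1 // => x; rewrite WP => /andP[_ xU]; rewrite degE big1 // => y yS.
  by case: (boolP (e x y)) => //; rewrite es => /(NS y x yS); rewrite (negPf xU).
have bound6 : arcs e (U :|: W) <= 6 * #|U :|: W|.
  have [/eqP|UW0] := posnP #|U :|: W|.
    by rewrite cards_eq0 => /eqP->; rewrite /arcs /cross big_set0.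
  have PUW : z2planar h (U :|: W) e by apply: z2planarW P; rewrite ?subsetT.
  have := arcs_z2planar ha es ei UW0 PUW; clear; lia.
have bound4 : 2 * cross e U S <= 4 * #|U :|: S|.
  pose e' : rel V := fun x y => e x y && ((x \in S) != (y \in S)).
  have e's : symmetric e' by move=> x y; rewrite /e' es eq_sym.
  have -> : cross e U S = cross e' U S.
    rewrite /cross; apply: eq_bigr => x xU; rewrite !degE; apply: eq_bigr => y yS.
    by rewrite /e' yS (negPf (US x xU)) andbT.
  apply: (@leq_trans (arcs e' (U :|: S))).
    rewrite arcsU 1?disjoint_sym //; clear; lia.
  (* The bipartite bound requires three vertices; for at most two, the square of their number
     suffices. *)
  have [small|big] := leqP #|U :|: S| 2.
    apply: leq_trans (arcs_leq_sq _ _) _; rewrite -mulnn leq_mul2r.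
    by rewrite (leq_trans small) // orbT.
  have P' : z2planar h (U :|: S) e'.
    by apply: z2planarW P; rewrite ?subsetT // => x y /andP[].
  have bip x y : e' x y -> (x \in S) != (y \in S) by case/andP.
  by have := bipartite_arcs_z2planar ha e's bip big P'; clear; lia.
have cV : #|V| = #|U| + #|W| + #|S|.
  rewrite -cardsT VE cardsU (disjoint_setI0 dUWS) cards0 subn0.
  by rewrite cardsU (disjoint_setI0 dUW) cards0 subn0.
rewrite cV VE arcsU // crossUl // crossWS arcsS cardsU (disjoint_setI0 dUI) cards0 subn0.
move: bound6 bound4 cI; rewrite !cardsU (disjoint_setI0 dUW) setIC (disjoint_setI0 dSU) cards0.
clear; lia.
Qed.

End DisjointEdges.

(** * Crossing parities of sampled plane curves *)

Section RayCrossings.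
Variable R : realType.
Implicit Types (p q r s : R * R) (d : R).
Local Open Scope ring_scope.

(** The half-plane with only its positive boundary ray: for nonzero [p] it contains exactly one of
    [p] and [- p]. Applied to differences it is the lexicographic comparison [h], second coordinate
    first. *)
Definition upper p : bool := (0 < p.2) || (p.2 == 0) && (0 < p.1).

(* Meaningful only if the segment pq is short compared with its distance to the
   origin: then p.1 and q.1 have the same sign whenever upper differs. *)
Definition crosses p q : bool := (upper p (+) upper q) && (0 < p.1).

Lemma upperN p : p != 0 -> upper (- p) = ~~ upper p.
Proof.
case: p => x y; rewrite /upper /= -pair_eqE /= => nz.
rewrite !oppr_gt0 oppr_eq0; move: nz.
by case: (ltrgtP y 0) => //= _; case: (ltrgtP x 0).
Qed.

Lemma prod_norm_lt p d : (`|p| < d) = (`|p.1| < d) && (`|p.2| < d).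
Proof. by rewrite [in LHS]/Num.norm /= gt_max. Qed.

(** The norm is the maximum norm. Second coordinates of opposite weak signs that differ by less than
    [d] are both smaller than [d], so the first coordinates have size at least [d]; differing by
    less than [d], they agree in sign. *)
Lemma upper_neq_mul_gt0 p q d : d <= `|p| -> d <= `|q| -> `|p - q| < d ->
  upper p != upper q -> 0 < p.1 * q.1.
Proof.
case: p q => [x y] [z t] dp dq dpq; have d0 : 0 < d by apply: le_lt_trans dpq.
move: dp dq dpq; rewrite !leNgt !prod_norm_lt /= !negb_and -!leNgt !ler_normr !ltr_norml.
move=> dp dq /andP[/andP[xz1 xz2] /andP[yt1 yt2]] upq.
have yt : 0 <= y /\ t <= 0 \/ y <= 0 /\ 0 <= t.
  move: upq; rewrite /upper /=.
  case: (ltrgtP y 0) => [y0|y0|y0]; case: (ltrgtP t 0) => [t0|t0|t0] //= _; lra.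
have dx : d <= x \/ x <= - d by case/orP: dp => /orP[] ?; lra.
have dz : d <= z \/ z <= - d by case/orP: dq => /orP[] ?; lra.
have [[x0 z0]|[x0 z0]] : 0 < x /\ 0 < z \/ x < 0 /\ z < 0 by lra.
  exact: mulr_gt0.
by rewrite nmulr_rgt0.
Qed.

(** Negation exchanges crossings of the positive and the negative ray, and each change of [upper]
    crosses exactly one of them. *)
Lemma crossesNN p q d : d <= `|p| -> d <= `|q| -> `|p - q| < d ->
  crosses (- p) (- q) = crosses p q (+) (upper p (+) upper q).
Proof.
move=> dp dq dpq; have d0 : 0 < d by apply: le_lt_trans dpq.
have p0 : p != 0 by rewrite -normr_gt0 (lt_le_trans d0).
have q0 : q != 0 by rewrite -normr_gt0 (lt_le_trans d0).
rewrite /crosses !upperN //; have := upper_neq_mul_gt0 dp dq dpq.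
by case: (upper p); case: (upper q) => //= /(_ isT); rewrite oppr_gt0;
  case: (ltrgtP p.1 0) => //= ->; rewrite mul0r ltxx.
Qed.

(** If [upper] is not constant on the corners, all first coordinates have the same sign, so either
    nothing is counted or the changes of [upper] telescope from [p] to [r] on both sides. *)
Lemma crosses_cell p q r s d :
  {in [:: p; q; r; s], forall x, d <= `|x|} ->
  {in [:: p; q; r; s] &, forall x y, `|x - y| < d} ->
  crosses p q (+) crosses q r = crosses p s (+) crosses s r.
Proof.
move=> dn dd.
have sgn x y : x \in [:: p; q; r; s] -> y \in [:: p; q; r; s] ->
    (upper x != upper y) ==> ((0 < x.1) == (0 < y.1)).
  move=> xP yP; apply/implyP.
  move=> /(upper_neq_mul_gt0 (dn x xP) (dn y yP) (dd x y xP yP)) xy0.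
  apply/eqP; apply/idP/idP => z0.
    by rewrite -(pmulr_rgt0 _ z0).
  by rewrite -(pmulr_lgt0 _ z0).
have inp : p \in [:: p; q; r; s] by rewrite !inE eqxx.
have inq : q \in [:: p; q; r; s] by rewrite !inE eqxx orbT.
have inr : r \in [:: p; q; r; s] by rewrite !inE eqxx !orbT.
have ins : s \in [:: p; q; r; s] by rewrite !inE eqxx !orbT.
move: (sgn _ _ inp inq) (sgn _ _ inp inr) (sgn _ _ inp ins) (sgn _ _ inq inr)
  (sgn _ _ inq ins) (sgn _ _ inr ins); rewrite /crosses.
move: (upper p) (upper q) (upper r) (upper s) (0 < p.1) (0 < q.1) (0 < r.1) (0 < s.1).
by clear; do 8!case.
Qed.

(** A discrete homotopy: pushing a lattice path across one cell at a time preserves its parity, so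
    both boundary paths between opposite corners agree. *)
Lemma crosses_grid (P : nat -> nat -> R * R) n m d :
  (forall i j, (i <= n)%N -> (j <= m)%N -> d <= `|P i j|) ->
  (forall i j k l, (i <= n)%N -> (j <= m)%N -> (k <= n)%N -> (l <= m)%N ->
     (i <= k.+1)%N -> (k <= i.+1)%N -> (j <= l.+1)%N -> (l <= j.+1)%N ->
     `|P i j - P k l| < d) ->
  \big[addb/false]_(i < n) crosses (P i 0) (P i.+1 0)
    (+) \big[addb/false]_(j < m) crosses (P n j) (P n j.+1) =
  \big[addb/false]_(j < m) crosses (P 0 j) (P 0 j.+1)
    (+) \big[addb/false]_(i < n) crosses (P i m) (P i.+1 m).
Proof.
move=> dn dd.
have cell i j : (i < n)%N -> (j < m)%N ->
    crosses (P i j) (P i.+1 j) (+) crosses (P i.+1 j) (P i.+1 j.+1) =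
    crosses (P i j) (P i j.+1) (+) crosses (P i j.+1) (P i.+1 j.+1).
  move=> lin ljm; apply: (@crosses_cell _ _ _ _ d).
    by move=> x; rewrite !inE => /or4P[] /eqP->; apply: dn => //; apply: ltnW.
  by move=> x y; rewrite !inE => /or4P[] /eqP-> /or4P[] /eqP->; apply: dd;
    first [exact: leqnn|exact: leqnSn|exact: lin|exact: ljm|exact: ltnW|
           exact/leqW/leqnSn].
have row k j : (k <= n)%N -> (j < m)%N ->
    \big[addb/false]_(i < k) crosses (P i j) (P i.+1 j)
      (+) crosses (P k j) (P k j.+1) =
    crosses (P 0 j) (P 0 j.+1)
      (+) \big[addb/false]_(i < k) crosses (P i j.+1) (P i.+1 j.+1).
  elim: k => [|k IH] kn jm; first by rewrite !big_ord0 addbF.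
  rewrite !big_ord_recr /= -addbA cell // !addbA IH //; exact: ltnW.
elim: m dn dd cell row => [|m IH] dn dd cell row.
  by rewrite !big_ord0 addbF.
rewrite !big_ord_recr /= addbA IH; first last.
- by move=> k j kn jm; apply: row => //; apply: ltnW.
- by move=> i j lin jm; apply: cell => //; apply: ltnW.
- by move=> i j k l lin jm kn lm *; apply: dd => //; apply: leqW.
- by move=> i j lin jm; apply: dn => //; apply: leqW.
by rewrite -!addbA row.
Qed.

End RayCrossings.

(** * Compactness: distance of disjoint sets and uniform continuity of paths *)

Section Paths.
Variable R : realType.
Local Open Scope classical_set_scope.
Local Open Scope ring_scope.
Implicit Types (f g : R -> R * R).

(** The distance attains its minimum on the compact product, and disjointness makes it nonzero. If
    the product is empty, any positive [d] will do. *)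
Lemma compact_dist_gt0 (A B : set (R * R)) : compact A -> compact B ->
  A `&` B = set0 -> exists2 d : R, 0 < d & forall p q, A p -> B q -> d <= `|p - q|.
Proof.
move=> cA cB AB0.
have [AB|nAB] := pselect ((A `*` B) !=set0); last first.
  by exists 1 => // p q Ap Bq; case: nAB; exists (p, q).
have cAB := compact_setX cA cB.
have cont : {within A `*` B, continuous (fun z => `|z.1 - z.2| : R)}.
  apply: continuous_subspaceT => z.
  apply: (@continuous_comp _ _ _ (fun z : (R * R) * (R * R) => z.1 - z.2) (fun p => `|p|)).
    by apply: sub_continuous.
  exact: norm_continuous.
have [c cin cmin] := compact_EVT_min AB cAB cont.
move: cin; rewrite inE => -[Ac Bc].
exists `|c.1 - c.2|.
  rewrite normr_gt0 subr_eq0; apply/eqP => c12.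
  have : (A `&` B) c.1 by split => //; rewrite c12.
  by rewrite AB0.
by move=> p q Ap Bq; apply: (cmin (p, q)); rewrite inE.
Qed.

(** Uniform continuity, from compactness of the interval. Stating it for all large [N] lets finitely
    many paths share one grid. *)
Lemma path_fine_grid f (e : R) : {within `[0, 1], continuous f} -> 0 < e ->
  \forall N \near \oo, forall s t, `[0, 1]%classic s -> `[0, 1]%classic t ->
    `|s - t| * N%:R <= 1 -> `|f s - f t| < e.
Proof.
move=> fc e0.
pose P (N : nat) (s : R) := forall t, `[0, 1]%classic t ->
    `|s - t| * N%:R <= 1 -> `|f s - f t| < e.
suff : \forall N \near \oo, `[0, 1]%classic `<=` P N.
  by apply: filterS => N NP s t sI tI; apply: NP.
have /compact_near_coveringP/near_covering_withinP cov := @segment_compact R 0 1.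
apply: cov => x xI.
have /cvgrPdist_lt/(_ (e / 2)) := (iffLR (subspace_continuousP _ _) fc) x xI.
have e2 : 0 < e / 2 by rewrite divr_gt0.
move=> /(_ e2); rewrite nearE /= => /nbhs_ballP[d /= d0 dP].
have near_x t : `|x - t| < d -> `[0, 1]%classic t -> `|f x - f t| < e / 2.
  by move=> xt tI; apply: dP.
near=> s N => sI t tI stN.
have sx : `|x - s| < d / 2.
  by near: s; apply: (nbhsx_ballx x (d/2)); rewrite divr_gt0.
have N0 : 2 / d < N%:R.
  by near: N; apply: nbhs_infty_gtr.
have Ngt0 : (0 : R) < N%:R by apply: lt_trans N0; rewrite divr_gt0.
have st : `|s - t| < d / 2.
  have := stN; rewrite -ler_pdivlMr // div1r => /le_lt_trans; apply.
  by rewrite -[d / 2]invf_div ltf_pV2 // posrE divr_gt0.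
rewrite (splitr e) -(subrKA (f x)) (le_lt_trans (ler_normD _ _)) // ltrD //.
  by rewrite distrC near_x // (lt_trans sx) // ltr_pdivrMr // ltr_pMr // ltr1n.
apply: near_x => //; rewrite -(subrKA s) (le_lt_trans (ler_normD _ _)) //.
by rewrite [ltRHS]splitr ltrD.
Unshelve. all: by end_near.
Qed.

End Paths.

(** * Drawings *)

Section Drawing.
Variables (R : realType) (G : sgraph) (pos : G -> R * R).
Variable arc : {set G} -> set (R * R).
Hypothesis drawn : is_drawing pos arc.
Local Open Scope classical_set_scope.
Local Open Scope ring_scope.

Lemma mem_edges (x y : G) : adj x y -> [set x; y]%SET \in edges G.
Proof. by move=> xy; apply/imsetP; exists (x, y); rewrite ?inE. Qed.

(** A common point is interior to neither arc, so it is the position of an end of each; injectivity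
    of [pos] would make these ends equal. *)
Lemma disjoint_arcs (x y z t : G) : adj x y -> adj z t ->
  x != z -> x != t -> y != z -> y != t ->
  arc [set x; y]%SET `&` arc [set z; t]%SET = set0.
Proof.
move=> xy zt xz xt yz yt; apply/seteqP; split=> // p [pA pB].
have AB : [set x; y]%SET != [set z; t]%SET.
  apply/eqP => /setP/(_ x); rewrite !inE eqxx /=.
  by rewrite (negPf xz) (negPf xt).
have endpoint A B : A \in edges G -> B \in edges G -> A != B -> arc A p -> arc B p ->
    exists2 v, v \in A & p = pos v.
  move=> eA eB nAB Ap Bp; apply: contrapT => nv.
  have : ((arc A `\` pos @` [set` A]) `&` arc B) p.
    by split=> //; split=> // -[v vA vp]; apply: nv; exists v.
  by rewrite (drawing_edge drawn).
have [v vA pv] := endpoint _ _ (mem_edges xy) (mem_edges zt) AB pA pB.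
have [w wB pw] := endpoint _ _ (mem_edges zt) (mem_edges xy) (contra_neqN (fun h => esym (eqP h)) AB) pB pA.
have vw : v = w by apply: (drawing_pos_inj drawn); rewrite -pv.
move: vA wB; rewrite vw !inE => /orP[]/eqP-> /orP[]/eqP e;
  by move: xz xt yz yt; rewrite e eqxx.
Qed.

(** All edges are sampled at the multiples of 1/N, and [crosses_grid] is applied to the differences
    of two disjoint edges. Two of the four boundary sums are parities as they stand; the other two
    look from the moving point, and turning them around produces the terms [h]. *)
Lemma drawing_z2planar :
  z2planar (fun x y => upper (pos y - pos x)) [set: G]%SET (@adj G).
Proof.
pose I01 : set R := `[0, 1]%classic.
(* Each ordered pair of adjacent vertices gets a parametrization from its first to its second end;
   other pairs get a constant path as default. *)
have /choice[F FP] : forall p : G * G, exists f : R -> R * R, adj p.1 p.2 ->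
    [/\ {within I01, continuous f}, f 0 = pos p.1, f 1 = pos p.2 &
        arc [set p.1; p.2]%SET = f @` I01].
  move=> p; case: (boolP (adj p.1 p.2)) => [ap|_]; last by exists (fun=> 0).
  by have [f [fc _ f0 f1 fE]] := drawing_arc drawn ap; exists f.
(* With [d / 2] for each curve, one step along both moves their difference by less than [d]. *)
pose fine (p : G * G) (N : nat) d := forall s t, I01 s -> I01 t -> `|s - t| * N%:R <= 1 ->
  `|F p s - F p t| < d / 2.
pose good (p q : G * G) (N : nat) :=
  adj p.1 p.2 -> adj q.1 q.2 -> p.1 != q.1 -> p.1 != q.2 -> p.2 != q.1 -> p.2 != q.2 ->
  exists d, [/\ forall s t, I01 s -> I01 t -> d <= `|F p s - F q t|, fine p N d & fine q N d].
have goodP (pq : (G * G) * (G * G)) : \forall N \near \oo, good pq.1 pq.2 N.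
  case: pq => p q; rewrite /good /=.
  have [ap|] := boolP (adj p.1 p.2); last by move=> _; apply: nearW.
  have [aq|] := boolP (adj q.1 q.2); last by move=> _; apply: nearW.
  have [e1|n1] := eqVneq p.1 q.1; first by apply: nearW.
  have [e2|n2] := eqVneq p.1 q.2; first by apply: nearW.
  have [e3|n3] := eqVneq p.2 q.1; first by apply: nearW.
  have [e4|n4] := eqVneq p.2 q.2; first by apply: nearW.
  have [pc _ _ pE] := FP p ap; have [qc _ _ qE] := FP q aq.
  have cp : compact (F p @` I01) by apply: continuous_compact => //; apply: segment_compact.
  have cq : compact (F q @` I01) by apply: continuous_compact => //; apply: segment_compact.
  have dpq : (F p @` I01) `&` (F q @` I01) = set0.
    by rewrite -pE -qE; apply: disjoint_arcs.
  have [d d0 dP] := compact_dist_gt0 cp cq dpq.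
  have d2 : 0 < d / 2 by rewrite divr_gt0.
  have := path_fine_grid pc d2; have := path_fine_grid qc d2.
  apply: filterS2 => N Nq Np _ _ _ _ _ _; exists d; split => //.
  by move=> s t sI tI; apply: dP; [exists s|exists t].
(* Finitely many pairs of edges have a common [N]. *)
have [N [N0 Ngood]] : exists N, (0 < N)%N /\ forall pq : (G * G) * (G * G), good pq.1 pq.2 N.
  apply: (@filter_ex _ \oo); apply: filterI; first exact: nbhs_infty_gt.
  exact: (@filter_forall nat ((G * G) * (G * G))%type
    (fun pq N => good pq.1 pq.2 N) \oo _ goodP).
have NR : (0 : R) < N%:R by rewrite ltr0n.
pose u (i : nat) : R := i%:R / N%:R.
have u0 : u 0%N = 0 by rewrite /u mul0r.
have uN : u N = 1 by rewrite /u divff // gt_eqF.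
have uI i : (i <= N)%N -> I01 (u i).
  move=> iN; rewrite /I01 /= in_itv /= divr_ge0 //=.
  by rewrite ler_pdivrMr // mul1r ler_nat.
have u_near i k : (i <= k.+1)%N -> (k <= i.+1)%N -> `|u i - u k| * N%:R <= 1.
  move=> ik ki; rewrite -[X in _ * X]ger0_norm ?ler0n // -normrM mulrBl !divfK ?gt_eqF //.
  have ik1 : (i%:R : R) <= k%:R + 1 by rewrite natr1 ler_nat.
  have ki1 : (k%:R : R) <= i%:R + 1 by rewrite natr1 ler_nat.
  by rewrite ler_norml; apply/andP; split; lra.
pose W x y v := \big[addb/false]_(i < N)
  crosses (F (x, y) (u i) - pos v) (F (x, y) (u i.+1) - pos v).
exists W => a a' b b' _ _ _ _ aa bb ab ab' a'b a'b'.
have [d [dfar pf qf]] := Ngood ((a, a'), (b, b')) aa bb ab ab' a'b a'b'.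
have [_ /= f0 f1 _] := FP (a, a') aa; have [_ /= g0 g1 _] := FP (b, b') bb.
pose f := F (a, a'); pose g := F (b, b').
have := @crosses_grid R (fun i j => f (u i) - g (u j)) N N d.
have gd i j : (i <= N)%N -> (j <= N)%N -> d <= `|f (u i) - g (u j)|.
  by move=> iN jN; apply: dfar; apply: uI.
move=> /(_ gd).
have step i j k l : (i <= N)%N -> (j <= N)%N -> (k <= N)%N -> (l <= N)%N ->
     (i <= k.+1)%N -> (k <= i.+1)%N -> (j <= l.+1)%N -> (l <= j.+1)%N ->
     `|f (u i) - g (u j) - (f (u k) - g (u l))| < d.
  move=> iN jN kN lN ik ki jl lj; rewrite opprB [g (u l) - _]addrC addrACA [- g _ + _]addrC.
  rewrite (splitr d) (le_lt_trans (ler_normD _ _)) // ltrD //.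
    by apply: pf; [exact: uI|exact: uI|exact: u_near].
  by apply: qf; [exact: uI|exact: uI|exact: u_near].
move=> /(_ step); rewrite u0 uN /f /g f0 f1 g0 g1 -/f -/g.
(* As an end of [f], [pos v] keeps distance [d] from [g], so [crossesNN] applies at every step and
   its corrections telescope. *)
have flip (v : G) i : (i <= N)%N -> v = a \/ v = a' ->
    \big[addb/false]_(j < i) crosses (pos v - g (u j)) (pos v - g (u j.+1)) =
    \big[addb/false]_(j < i) crosses (g (u j) - pos v) (g (u j.+1) - pos v)
      (+) (upper (pos b - pos v) (+) upper (g (u i) - pos v)).
  move=> + va; elim: i => [|i IH] iN; first by rewrite !big_ord0 u0 /g g0 addbb.
  rewrite !big_ord_recr /= IH 1?ltnW // -2!(opprB (g _)).
  have [i0 [i0N ->]] : exists i0, (i0 <= N)%N /\ pos v = f (u i0).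
    by case: va => ->; [exists 0%N; rewrite u0|exists N; rewrite uN leqnn].
  rewrite (@crossesNN _ _ _ d).
  - by do ![case: (upper _)]; do ![case: (crosses _ _)]; case: (\big[_/_]_(_ < _) _).
  - by rewrite distrC gd // ltnW.
  - by rewrite distrC gd.
  - rewrite opprB addrA subrK (lt_trans (qf _ _ (uI _ (ltnW iN)) (uI _ iN) _)) //.
      by apply: u_near; rewrite ?leqnSn // leqW.
    have d0 : 0 < d.
      by have := step 0%N 0%N 0%N 0%N isT isT isT isT isT isT isT isT;
        apply: le_lt_trans.
    by rewrite ltr_pdivrMr // ltr_pMr // ltr1n.
rewrite (flip a N) //; last by left.
rewrite (flip a' N) //; last by right.
rewrite uN /g g1 -/g /bal -/(W a a' b) -/(W a a' b') -/(W b b' a) -/(W b b' a').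
move: (W a a' b) (W a a' b') (W b b' a) (W b b' a') (upper (pos b - pos a))
  (upper (pos b' - pos a)) (upper (pos b - pos a')) (upper (pos b' - pos a')).
by clear; do 8!case.
Qed.

Lemma drawing_upper_anti (x y : G) : x != y ->
  upper (pos y - pos x) = ~~ upper (pos x - pos y).
Proof.
move=> xy; rewrite -upperN ?opprB // subr_eq0.
by apply: contra_neq xy => /(drawing_pos_inj drawn).
Qed.

End Drawing.

(** * From ordered pairs and injections to edges and matchings *)

Section Matching.
Variable G : sgraph.

(** Every edge arises from its two orderings, which differ because there are no loops. *)
Lemma card_edges_le_arcs : (2 * #|edges G| <= arcs (@adj G) [set: G])%N.
Proof.
pose D := [set p : G * G | adj p.1 p.2]%SET.
have -> : arcs (@adj G) [set: G] = #|D|.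
  rewrite /arcs /cross (eq_bigr _ (fun x _ => degE (@adj G) [set: G] x)).
  rewrite pair_big -[RHS]sum1_card [RHS]big_mkcond /=.
  by apply: eq_big => [p|p _]; rewrite !inE // -/(adj _ _); case: (adj _ _).
pose f (p : G * G) := [set p.1; p.2]%SET.
rewrite -[leqRHS]sum1_card (partition_big f (mem (edges G))) /=; last first.
  by move=> p; rewrite inE => ap; apply: mem_edges.
rewrite mulnC -sum_nat_const; apply: leq_sum => _ /imsetP[[x y] + ->] /=.
rewrite inE /= => xy; rewrite sum1_card; apply/card_gt1P.
have inD p : (p \in D) = adj p.1 p.2 by rewrite inE.
exists (x, y), (y, x); split.
- by apply/andP; split; rewrite ?eqxx //; have := inD (x, y); rewrite xy.
- apply/andP; split; last by rewrite /f /= finset.setUC eqxx.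
  by have := inD (y, x); rewrite adj_sym xy.
- by apply/eqP => -[xy' _]; move: xy; rewrite xy' adj_irrefl.
Qed.

(** Two edges can meet in two elements of [D], in two images, or in one of each; distinctness,
    injectivity and [g x \notin D] exclude these cases. *)
Lemma matching_of_injection (D : {set G}) (g : G -> G) :
  {in D &, injective g} -> {in D, forall x, g x \notin D} ->
  {in D, forall x, adj x (g x)} ->
  exists M : {set {set G}}, matching M /\ #|M| = #|D|.
Proof.
move=> ginj gD gadj; pose e x := [set x; g x]%SET.
have einj : {in D &, injective e}.
  move=> x y xD yD /setP/(_ x); rewrite !inE eqxx /= => /esym/orP[/eqP//|/eqP xg].
  by move: (gD y yD); rewrite -xg xD.
exists (e @: D)%SET; split; last exact: card_in_imset.
split.
  by apply/fintype.subsetP => _ /imsetP[x xD ->]; apply: mem_edges; apply: gadj.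
apply/finset.trivIsetP => _ _ /imsetP[x xD ->] /imsetP[y yD ->] exy.
have xy : x != y by apply: contra_neq exy => ->.
rewrite -finset.setI_eq0; apply/eqP/setP => z; rewrite !inE; apply/negP.
case/andP => /orP[]/eqP-> /orP[]/eqP zz.
- by move: xy; rewrite zz eqxx.
- by move: (gD y yD); rewrite -zz xD.
- by move: (gD x xD); rewrite zz yD.
- by move: xy; rewrite (ginj x y xD yD zz) eqxx.
Qed.

End Matching.

Local Open Scope ring_scope.

Theorem lemma5 (R : realType) (G : sgraph) (n m : nat)
    (hplanar : planar R G) (hn : #|G| = n) (hm : #|edges G| = m) :
  exists M : {set {set G}},
    matching M /\ (m%:R - 2 * n%:R) / 3 <= (#|M|%:R : rat).
Proof.
have [pos [arc drawn]] := hplanar.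
have [D [g [ginj gD gadj bound]]] := z2planar_disjoint_edges
  (drawing_upper_anti drawn) (@adj_sym G) (@adj_irrefl G) (drawing_z2planar drawn).
have [M [matchM cM]] := matching_of_injection ginj gD gadj.
exists M; split => //; rewrite cM -hn -hm.
have := leq_trans (card_edges_le_arcs G) bound; rewrite leq_pmul2l // => mle.
by rewrite ler_pdivrMr // lerBlDr -!natrM -natrD ler_nat addnC [(#|D| * 3)%N]mulnC.
Qed.
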